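(* Let $G$ be a compactly generated, totally disconnected, locally compact group. Then the following are equivalent: (1) $G$ is amenable and unimodular; (2) $G$ is geometrically amenable; (3) there exists a bounded-degree amenable graph admitting a proper Lipschitz action of $G$; (4) there exists a connected, locally finite, amenable graph admitting a proper quasitransitive action of $G$; (5) there exists a connected, locally finite, amenable graph admitting a proper transitive action of $G$; (6) every connected, locally finite graph admitting a proper quasitransitive action of $G$ is amenable.
   Context: Groups. Let $\mu$ be a (left) Haar measure on a locally compact group $G$. The modular homomorphism $\Delta_G:G\to\mathbb{R}^*_+$ is defined by $\mu(Ag)=\Delta_G(g)\mu(A)$ for all Borel $A\subseteq G$ and $g\in G$; $G$ is unimodular if $\Delta_G\equiv 1$. $G$ is amenable if for every compact $K\subseteq G$ and every $\varepsilon>0$ there is a compact set $U\subseteq G$ of positive measure with $\mu(KU)/\mu(U)\le 1+\varepsilon$. $G$ is geometrically amenable if for every compact $K\subseteq G$ and every $\varepsilon>0$ there is a compact set $U\subseteq G$ of positive measure with $\mu(UK)/\mu(U)\le 1+\varepsilon$. Graphs. Graphs are identified with their vertex sets and carry the graph distance $d$. For a set $A$ of vertices of a graph $\Gamma$, $\partial A$ is the set of vertices not in $A$ that have a neighbour in $A$. The Cheeger constant is $\mathrm{h}(\Gamma)=\inf |\partial A|/|A|$ over finite non-empty sets $A$ of vertices, and $\Gamma$ is amenable if $\mathrm{h}(\Gamma)=0$. Actions. All actions of topological groups on graphs are by graph automorphisms and continuous, i.e. the induced homomorphism $G\to\mathrm{Aut}(\Gamma)$ is continuous for the topology of pointwise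 convergence on $\mathrm{Aut}(\Gamma)$. An action is proper if vertex stabilisers are compact in $G$; transitive if there is a unique orbit of vertices; quasitransitive if there are only finitely many orbits of vertices. For a compactly generated locally compact group $G$ acting properly on a locally finite graph $\Gamma$ and $C>0$, the action is $C$-Lipschitz with respect to a compact symmetric generating set $S$ of $G$ if in each orbit there is some vertex $x$ such that the orbit map $(G,S)\to G\cdot x$, $g\mapsto g\cdot x$, is $C$-Lipschitz, where $(G,S)$ is $G$ with the word metric of $S$ and $G\cdot x$ carries the distance of $\Gamma$. The action is $C$-Lipschitz if this holds for some $S$, and Lipschitz if it is $C$-Lipschitz for some $C>0$. *)

(* Defs.v *)
From HB Require Import structures.
From mathcomp Require Import all_boot all_order all_algebra.
From mathcomp Require Import all_classical all_reals all_analysis.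

Set Implicit Arguments.
Unset Strict Implicit.
Unset Printing Implicit Defensive.

Import Order.TTheory GRing.Theory Num.Theory.

Local Open Scope classical_set_scope.
Local Open Scope ring_scope.

(* The base point required by [PointedTopological] is arbitrary; it is only
   there because the library's measurable types are pointed. *)
HB.mixin Record PointedTopological_isTopologicalGroup G
    of PointedTopological G & Group G := {
  mulg_continuous : continuous (fun p : G * G => (p.1 * p.2)%g);
  invg_continuous : continuous (fun x : G => (x^-1)%g)
}.

#[short(type="topologicalGroupType")]
HB.structure Definition TopologicalGroup :=
  {G of PointedTopological G & Group G
      & PointedTopological_isTopologicalGroup G}.

Definition borel (T : ptopologicalType) := g_sigma_algebraType (@open T).

Section TopologicalGroups.
Variable G : topologicalGroupType.
Implicit Types (A K U S H : set G) (g h : G).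

Definition set_mulg A B : set G := [set (a * b)%g | a in A & b in B].

Definition is_subgroup H : Prop :=
  [/\ H 1%g, (forall g h, H g -> H h -> H (g * h)%g)
    & (forall g, H g -> H (g^-1)%g)].

Definition generates S : Prop :=
  forall H, is_subgroup H -> S `<=` H -> H = [set: G].

Definition compactly_generated : Prop := exists S, compact S /\ generates S.

Definition symmetric_set S : Prop := forall g, S g -> S (g^-1)%g.

Definition is_word S (n : nat) g : Prop :=
  exists s : seq G,
    [/\ size s = n, (forall x, x \in s -> S x) & (\prod_(x <- s) x)%g = g].

Variable R : realType.

(* The left-invariant word metric. *)
Definition word_dist S g h : \bar R :=
  ereal_inf [set (n%:R)%:E | n in [set n : nat | is_word S n (g^-1 * h)%g]].

(* A left Haar measure is a nonzero left-invariant Radon measure. *)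
Record is_left_haar (mu : {measure set (borel G) -> \bar R}) : Prop := {
  haar_neq0 : mu [set: G] <> 0%E;
  haar_left_invariant : forall g (A : set (borel G)),
    measurable A -> mu (set_mulg [set g] A) = mu A;
  haar_compact : forall K, compact K -> (mu K < +oo)%E;
  haar_outer_regular : forall A : set (borel G), measurable A ->
    mu A = ereal_inf [set mu U | U in [set U : set G | open U /\ A `<=` U]];
  haar_inner_regular : forall U, open U ->
    mu U = ereal_sup [set mu K | K in [set K : set G | compact K /\ K `<=` U]]
}.

Variable mu : {measure set (borel G) -> \bar R}.

Definition modular g : R :=
  xget 0 [set r : R | (0 < r)%R /\
    forall A : set (borel G), measurable A ->
      mu (set_mulg A [set g]) = (r%:E * mu A)%E].

Definition unimodular : Prop := forall g, modular g = 1%R.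

Definition amenable_group : Prop :=
  forall K, compact K -> forall eps : R, (0 < eps)%R ->
  exists U, [/\ compact U, (0 < mu U)%E
              & (mu (set_mulg K U) / mu U <= (1 + eps)%:E)%E].

Definition geometrically_amenable_group : Prop :=
  forall K, compact K -> forall eps : R, (0 < eps)%R ->
  exists U, [/\ compact U, (0 < mu U)%E
              & (mu (set_mulg U K) / mu U <= (1 + eps)%:E)%E].

End TopologicalGroups.

Record graph := Graph {
  vertex :> choiceType;
  adj : vertex -> vertex -> Prop;
  adj_sym : forall x y, adj x y -> adj y x;
  adj_irrefl : forall x, ~ adj x x
}.

Section Graphs.
Variable Gam : graph.
Implicit Types (x y z : Gam) (A : set Gam).

Fixpoint walk (n : nat) x y : Prop :=
  if n is m.+1 then exists2 z, adj x z & walk m z y else x = y.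

(* The empty graph is not connected. *)
Definition connected_graph : Prop :=
  [set: Gam] !=set0 /\ forall x y, exists n, walk n x y.

Definition locally_finite_graph : Prop :=
  forall x, finite_set [set y | adj x y].

Definition bounded_degree : Prop :=
  exists D : nat, forall x, ([set y | adj x y] #<= `I_D)%card.

Definition boundary A : set Gam :=
  [set y | ~ A y /\ exists2 x, A x & adj x y].

Variable R : realType.

(* Equal to +oo when x and y lie in different components. *)
Definition graph_dist x y : \bar R :=
  ereal_inf [set (n%:R)%:E | n in [set n : nat | walk n x y]].

Definition cheeger : \bar R :=
  ereal_inf [set (counting (boundary A) / counting A)%E
            | A in [set A : set Gam | finite_set A /\ A !=set0]].

Definition amenable_graph : Prop := cheeger = 0%E.

End Graphs.

(* Each act g is bijective by act1 and actM. The topology of pointwise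
   convergence on the automorphism group is the one induced by the inclusion
   into the space of all maps from the discrete vertex set to itself. *)
Record graph_action (G : topologicalGroupType) (Gam : graph) := GraphAction {
  act :> G -> Gam -> Gam;
  act1 : forall x, act 1%g x = x;
  actM : forall g h x, act (g * h)%g x = act g (act h x);
  act_adj : forall g x y, adj (act g x) (act g y) <-> adj x y;
  act_continuous :
    continuous (act : G -> {ptws Gam -> discrete_topology Gam})
}.

Section Actions.
Variables (G : topologicalGroupType) (Gam : graph) (a : graph_action G Gam).

Definition orbit_of (x : Gam) : set Gam := [set a g x | g in [set: G]].

Definition orbits : set (set Gam) := [set orbit_of x | x in [set: Gam]].

Definition stabiliser (x : Gam) : set G := [set g | a g x = x].

Definition proper_action : Prop := forall x, compact (stabiliser x).

Definition transitive_action : Prop := exists O, orbits = [set O].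

Definition quasitransitive_action : Prop := finite_set orbits.

Variable R : realType.

Definition lipschitz_action_wrt (S : set G) (C : R) : Prop :=
  forall O, orbits O -> exists2 x, O x &
    forall g h, (graph_dist R (a g x) (a h x) <= C%:E * word_dist R S g h)%E.

Definition lipschitz_action : Prop :=
  exists C : R, (0 < C)%R /\
  exists S : set G,
    [/\ compact S, symmetric_set S, generates S & lipschitz_action_wrt S C].

End Actions.

(* Main.v *)
Require Import Defs.
From HB Require Import structures.
From mathcomp Require Import all_boot all_order all_algebra finmap.
From mathcomp Require Import all_classical all_reals all_analysis.

(** Write Delta for the modular function, m for the Haar measure, and call a
    compact set U of positive measure with m(UK) <= (1 + e) m(U) a right Folner
    set for (K, e).

    The group conditions.  If U is a right Folner set for ({g}, e), then
    Delta(g) m(U) = m(Ug) <= (1 + e) m(U).  Hence geometric amenability forces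
    Delta <= 1, so Delta = 1 since Delta(g) Delta(g^-1) = 1.  In a unimodular
    group inversion preserves m, and U |-> U^-1 exchanges left and right Folner
    sets (amenable_unimodular_geometric).  Both steps rest on the uniqueness of
    Haar measure, applied to the images of m under right translations and under
    inversion.  In a totally disconnected group uniqueness amounts to counting
    cosets: by van Dantzig's theorem the compact open subgroups form a basis at
    1, two compact open sets are finite unions of left cosets of one common
    compact open subgroup, and regularity extends the proportionality obtained
    from there to all Borel sets (haar_transport_unique).

    The link with graphs.  In a proper action the stabiliser of a vertex x is a
    compact open subgroup, and the set of g carrying x into a finite set B of
    vertices is a union of as many of its cosets as B has elements in the orbit
    of x (haar_transporter).  So cardinals in an orbit are Haar measures up to a
    factor that is constant on the orbit.

    From groups to graphs: if L is a right Folner set for a compact K that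
    contains every g moving an orbit representative next to another one, then
    the set of all g x with g in L and x a representative has a boundary that
    is small in each of the finitely many orbits (geometric_to_graph).

    From graphs to groups: given a compact K, the Lipschitz condition provides r
    such that g x and g k x are at distance at most r for k in K and all base
    points x; this needs K to lie in a ball of the word metric
    (compact_sub_word_ball).  Take a finite A with boundary so small that its
    r-neighbourhood has at most e |A| points outside A.  There may be infinitely
    many orbits, with stabilisers of unrelated measures, but by pigeonhole one
    of them inherits the inequality, and the set of g with g x in A, for the
    base point x of that orbit, is a right Folner set for (K, e)
    (lipschitz_to_geometric).

    The remaining implications produce graphs: a quasitransitive action on a
    connected locally finite graph is Lipschitz, and the Cayley-Abels graph on
    the cosets of a compact open subgroup carries a proper transitive action. *)

Set Implicit Arguments.
Unset Strict Implicit.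
Unset Printing Implicit Defensive.

Import Order.TTheory GRing.Theory Num.Theory.

(** * Topological groups *)

Section TopologicalGroup.
Local Open Scope classical_set_scope.
Local Open Scope group_scope.
Variable G : topologicalGroupType.
Implicit Types (A B C D K N U V W : set G) (g h x y : G).

Lemma continuous_mulg (T : topologicalType) (f1 f2 : T -> G) :
  continuous f1 -> continuous f2 -> continuous (fun t => f1 t * f2 t).
Proof.
move=> c1 c2 t.
apply: (@continuous2_cvg _ _ _ _ _ _ f1 f2 (fun a b => a * b)); last exact: c2.
  exact: (@mulg_continuous G (f1 t, f2 t)).
exact: c1.
Qed.

Lemma continuous_invg (T : topologicalType) (f : T -> G) :
  continuous f -> continuous (fun t => (f t)^-1).
Proof.
move=> c t; apply: (@cvg_comp _ _ _ f (fun x => x^-1) _ _ _ (c t)).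
exact: invg_continuous.
Qed.

Lemma lmul_continuous g : continuous (fun x : G => g * x).
Proof.
apply: (@continuous_mulg G (fun=> g) id) => x; first exact: cvg_cst.
exact: cvg_id.
Qed.

Lemma rmul_continuous g : continuous (fun x : G => x * g).
Proof.
apply: (@continuous_mulg G id (fun=> g)) => x; first exact: cvg_id.
exact: cvg_cst.
Qed.

Lemma set_mulg1E g A : set_mulg [set g] A = (fun x => g^-1 * x) @^-1` A.
Proof.
apply/seteqP; split=> [_ [_ -> [a Aa <-]]|x /= Ax]; first by rewrite /= mulKg.
by exists g => //; exists (g^-1 * x) => //; rewrite mulVKg.
Qed.

Lemma set_mulgE1 g A : set_mulg A [set g] = (fun x => x * g^-1) @^-1` A.
Proof.
apply/seteqP; split=> [_ [a Aa [_ -> <-]]|x /= Ax]; first by rewrite /= mulgK.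
by exists (x * g^-1) => //; exists g => //; rewrite mulgVK.
Qed.

Lemma open_ltranslate g A : open A -> open (set_mulg [set g] A).
Proof.
move=> oA; rewrite set_mulg1E; apply: open_comp => // x _.
exact: lmul_continuous.
Qed.

Lemma open_rtranslate g A : open A -> open (set_mulg A [set g]).
Proof.
move=> oA; rewrite set_mulgE1; apply: open_comp => // x _.
exact: rmul_continuous.
Qed.

Lemma set_mulgS A B C D :
  A `<=` B -> C `<=` D -> set_mulg A C `<=` set_mulg B D.
Proof.
by move=> AB CD _ [a /AB Ba [c /CD Dc <-]]; exists a => //; exists c.
Qed.

Lemma set_mulg_bigcup A B :
  set_mulg A B = \bigcup_(a in A) set_mulg [set a] B.
Proof.
apply/seteqP; split=> [_ [a Aa [b Bb <-]]|_ [a Aa [_ -> [b Bb <-]]]].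
  by exists a => //; exists a => //; exists b.
by exists a => //; exists b.
Qed.

Lemma open_mulg A B : open B -> open (set_mulg A B).
Proof.
move=> oB; rewrite set_mulg_bigcup; apply: bigcup_open => a _.
exact: open_ltranslate.
Qed.

Lemma compact_mulg A B : compact A -> compact B -> compact (set_mulg A B).
Proof.
move=> cA cB.
have -> : set_mulg A B = (fun p : G * G => p.1 * p.2) @` (A `*` B).
  apply/seteqP; split=> [_ [a Aa [b Bb <-]]|_ [[a b] [Aa Bb] <-]].
    by exists (a, b).
  by exists a => //; exists b.
apply: continuous_compact; last exact: compact_setX.
by apply: continuous_subspaceT; exact: mulg_continuous.
Qed.

Lemma compact_preimage_invg A :
  compact A -> compact ((fun x : G => x^-1) @^-1` A).
Proof.
move=> cA; have -> : (fun x : G => x^-1) @^-1` A = (fun x : G => x^-1) @` A.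
  apply/seteqP; split=> [x /= Ax|_ [a Aa <-]]; last by rewrite /= invgK.
  by exists x^-1 => //; rewrite invgK.
apply: continuous_compact => //.
by apply: continuous_subspaceT; exact: invg_continuous.
Qed.

Lemma mulg_tube A W : compact A -> open W -> A `<=` W ->
  exists N, [/\ open N, N 1 & set_mulg A N `<=` W].
Proof.
move=> /compact_near_coveringP cA oW AW.
have /cA : forall x, A x ->
    \forall x' \near x & i \near nbhs (1 : G), W (x' * i).
  move=> x Ax; have := @mulg_continuous G (x, 1) W; rewrite /= mulg1.
  by apply; apply: open_nbhs_nbhs; split=> //; exact: AW.
move=> /= nW.
have : nbhs (1 : G) [set n | A `<=` (fun x => W (x * n))] by exact: nW.
rewrite nbhsE => -[N [oN N1] NA]; exists N; split => //.
by move=> _ [a Aa [n Nn <-]]; exact: NA.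
Qed.

Lemma mulg_tube_l A W : compact A -> open W -> A `<=` W ->
  exists N, [/\ open N, N 1 & set_mulg N A `<=` W].
Proof.
move=> /compact_near_coveringP cA oW AW.
have /cA : forall x, A x ->
    \forall x' \near x & i \near nbhs (1 : G), W (i * x').
  move=> x Ax; have := @continuous_mulg (G * G)%type snd fst _ _ (x, 1) W.
  rewrite /= mul1g; apply.
  - by move=> p; exact: cvg_snd.
  - by move=> p; exact: cvg_fst.
  - by apply: open_nbhs_nbhs; split=> //; exact: AW.
move=> /= nW.
have : nbhs (1 : G) [set n | A `<=` (fun x => W (n * x))] by exact: nW.
rewrite nbhsE => -[N [oN N1] NA]; exists N; split => //.
by move=> _ [n Nn [a Aa <-]]; exact: NA.
Qed.

Lemma open_divg W : open W -> W 1 ->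
  exists N, [/\ open N, N 1 & forall a b, N a -> N b -> W (a * b^-1)].
Proof.
move=> oW W1.
have := @continuous_mulg (G * G)%type fst (fun p => (snd p)^-1) _ _ (1, 1) W.
case.
- by move=> p; exact: cvg_fst.
- by apply: continuous_invg => p; exact: cvg_snd.
- by rewrite /= invg1 mulg1; exact: open_nbhs_nbhs.
move=> [A B] /= [A1 B1] AB.
have : nbhs (1 : G) (A `&` B) by exact: filterI.
rewrite nbhsE => -[N [oN N1] NAB]; exists N; split=> // a b /NAB[Aa _].
by move=> /NAB[_ Bb]; exact: (AB (a, b)).
Qed.

Lemma open_subgroup_closed U : is_subgroup U -> open U -> closed U.
Proof.
move=> [U1 UM UV] oU; rewrite -[U]setCK; apply: open_closedC.
have -> : ~` U = set_mulg (~` U) U; last exact: open_mulg.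
apply/seteqP; split=> [y nUy|_ [y nUy [u Uu <-]]].
  by exists y => //; exists 1 => //; rewrite mulg1.
by move=> Uyu; apply: nUy; rewrite -(mulgK u y); apply: UM => //; exact: UV.
Qed.

Definition compact_open_subgroup U := [/\ is_subgroup U, compact U & open U].

End TopologicalGroup.

(** * Compact open subgroups of totally disconnected groups *)

Section VanDantzig.
Local Open Scope classical_set_scope.
Local Open Scope group_scope.
Variable G : topologicalGroupType.
Implicit Types (A B C D K N U V W : set G) (g h x y : G).
Hypothesis G_td : totally_disconnected [set: G].

(** Points are closed because connected components are, and in a topological
    group this separates points: x^-1 y avoids 1 for (x, y) near (p, q). *)
Lemma td_hausdorff : hausdorff_space G.
Proof.
have cl1 x : closed [set x].
  by rewrite -(G_td (x := x) I); apply: component_closed; exact: closedT.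
move=> p q clpq; apply: contrapT => npq.
have := @continuous_mulg G (G * G)%type (fun p => (fst p)^-1) snd _ _ (p, q)
  (~` [set 1]).
case.
- by apply: continuous_invg => r; exact: cvg_fst.
- by move=> r; exact: cvg_snd.
- apply: open_nbhs_nbhs; split; first exact: closed_openC.
  by move=> /= /eqP; rewrite mulg_eq1 => /eqP /invg_inj.
move=> [A B] /= [Ap Bq] AB.
have [x [Ax Bx]] := clpq _ _ Ap Bq.
by apply: (AB (x, x)) => //=; rewrite mulVg.
Qed.

Lemma td_compact_closed A : compact A -> closed A.
Proof. by apply: compact_closed; exact: td_hausdorff. Qed.

(** Otherwise the sets D minus O, for D in F, generate a proper filter, and a
    cluster point of it lies in every member of F but not in O. *)
Lemma compact_bigcap_sub_open (O C : set G) (F : set (set G)) :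
  compact C -> open O -> F C ->
  (forall D E, F D -> F E -> F (D `&` E)) -> (forall D, F D -> closed D) ->
  \bigcap_(D in F) D `<=` O -> exists2 D, F D & D `<=` O.
Proof.
move=> cC oO FC FI Fcl FO; apply: contrapT => nF.
pose B := filter_from F (fun D => D `\` O).
have BF : ProperFilter B.
  apply: filter_from_proper; last first.
    move=> D FD; apply/set0P/eqP => DO.
    by apply: nF; exists D => //; rewrite -setD_eq0.
  apply: filter_from_filter; first by exists C.
  by move=> D E FD FE; exists (D `&` E); [exact: FI|move=> x [[? ?] ?]].
have [|p [Cp clp]] := cC _ BF; first by exists C => // x [].
have clD D : F D -> closed (D `\` O).
  by move=> FD; rewrite setDE; apply: closedI; [exact: Fcl|exact: open_closedC].
have DOp D : F D -> (D `\` O) p.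
  by move=> FD; apply: (clD _ FD) => V Vp; apply: clp => //; exists D.
by have [_] := DOp _ FC; apply; apply: FO => D /DOp[].
Qed.

(** For closed C, these are the neighbourhoods of x in C that are open and
    closed for the subspace topology. *)
Definition relative_clopens C x : set (set G) :=
  [set D | [/\ D x, closed D, closed (C `\` D) & D `<=` C]].

Lemma relative_clopensT C x : closed C -> C x -> relative_clopens C x C.
Proof. by move=> clC Cx; split=> //; rewrite setDv; exact: closed0. Qed.

Lemma relative_clopensI C x D E : relative_clopens C x D ->
  relative_clopens C x E -> relative_clopens C x (D `&` E).
Proof.
move=> [Dx cD cD' DC] [Ex cE cE' EC]; split=> //; last by move=> y [/DC].
  exact: closedI.
by rewrite setDIr; exact: closedU.
Qed.

Lemma relative_clopens_split C x D V W : relative_clopens C x D ->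
  open V -> open W -> (forall y, V y -> W y -> False) -> D `<=` V `|` W ->
  V x -> relative_clopens C x (D `&` V).
Proof.
move=> [Dx cD cD' DC] oV oW VW DVW Vx; split=> //; last by move=> y [/DC].
  have -> : D `&` V = D `&` ~` W.
    apply/seteqP; split=> y [Dy Vy]; split=> //; first by move=> /(VW _ Vy).
    by case: (DVW y Dy).
  by apply: closedI => //; exact: open_closedC.
have -> : C `\` (D `&` V) = (C `\` D) `|` (D `&` ~` V).
  apply/seteqP; split=> y; last first.
    by case=> [[Cy nDy]|[/[dup] /DC ? ? nV]]; split=> // -[].
  move=> [Cy nDV]; have [Dy|nDy] := pselect (D y); [right|left]; split=> //.
  by move=> Vy; apply: nDV.
by apply: closedU => //; apply: closedI => //; exact: open_closedC.
Qed.

(** If Q, the quasi-component of x in C, were the union of two disjoint closed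
    parts, then disjoint open neighbourhoods of the parts would cover some
    relatively clopen D; the piece of D around x is again relatively clopen,
    hence contains Q, and the other part is empty. *)
Lemma quasicomponent_connected C x : compact C -> C x ->
  connected (\bigcap_(D in relative_clopens C x) D).
Proof.
move=> cC Cx; set F := relative_clopens C x; set Q := \bigcap_(D in F) D.
have clC := td_compact_closed cC.
have FC : F C by exact: relative_clopensT.
have Fcl D : F D -> closed D by case.
have FI D E : F D -> F E -> F (D `&` E) by exact: relative_clopensI.
have clQ : closed Q by apply: closed_bigI => D /Fcl.
have QC : Q `<=` C by move=> y; exact.
move=> B [b Bb] [U oU BU] [K cK BK].
have BQ : B `<=` Q by rewrite BU => y [].
have cB : compact B.
  apply: (subclosed_compact _ cC); first by rewrite BK; exact: closedI.
  exact: subset_trans QC.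
have clQB : closed (Q `\` B).
  have -> : Q `\` B = Q `&` ~` U.
    apply/seteqP; split=> y [Qy nBy]; split=> //.
      by move=> Uy; apply: nBy; rewrite BU; split.
    by rewrite BU => -[_]; apply: nBy.
  by apply: closedI => //; exact: open_closedC.
have [||N [oN N1 BN]] := @mulg_tube _ B (~` (Q `\` B)) cB.
- exact: closed_openC.
- by move=> y By [].
have [N' [oN' N'1 N'N]] := open_divg oN N1.
(* As N' N'^-1 lies in N, the products of B and of its complement in Q with N'
   are disjoint. *)
pose W1 := set_mulg B N'; pose W2 := set_mulg (Q `\` B) N'.
have oW1 : open W1 by exact: open_mulg.
have oW2 : open W2 by exact: open_mulg.
have BW1 : B `<=` W1.
  by move=> y By; exists y => //; exists 1 => //; rewrite mulg1.
have QBW2 : Q `\` B `<=` W2.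
  by move=> y By; exists y => //; exists 1 => //; rewrite mulg1.
have W12 y : W1 y -> W2 y -> False.
  move=> [b1 Bb1 [n1 Nn1 <-]] [b2 Bb2 [n2 Nn2 /(congr1 (fun y => y * n2^-1))]].
  rewrite mulgK -mulgA => e; apply: (BN b2); last exact: Bb2.
  by rewrite e; exists b1 => //; exists (n1 * n2^-1) => //; exact: N'N.
have [|D FD DW] := compact_bigcap_sub_open cC (openU oW1 oW2) FC FI Fcl.
  move=> y Qy; have [By|nBy] := pselect (B y); first by left; exact: BW1.
  by right; exact: QBW2.
have Qx : Q x by move=> D' [].
have [Bx|nBx] := pselect (B x).
  apply/seteqP; split=> // y Qy; apply: contrapT => nBy.
  have FDW := relative_clopens_split FD oW1 oW2 W12 DW (BW1 _ Bx).
  by have [_ /W12] := Qy _ FDW; apply; exact: QBW2.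
have W21 y : W2 y -> W1 y -> False by move=> w2 /W12; apply.
have W2x : W2 x by exact: QBW2.
have FDW : F (D `&` W2).
  by apply: (relative_clopens_split FD oW2 oW1 W21 _ W2x); rewrite setUC.
by have [_ /W21] := BQ _ Bb _ FDW; case; exact: BW1.
Qed.

Hypothesis G_lc : locally_compact [set: G].

(** In a compact neighbourhood C of x the intersection of the relatively clopen
    neighbourhoods of x is connected, hence equal to [set x], so one of them
    lies in the interior of the intersection of C and W and is open in G. *)
Lemma compact_open_nbhs W x : nbhs x W ->
  exists V, [/\ compact V, open V, V x & V `<=` W].
Proof.
move=> Wx; have := G_lc (x := x) I.
rewrite /= => -[C]; rewrite withinET => nC [cC clC].
have Cx : C x by exact: nbhs_singleton.
pose F := relative_clopens C x.
have FC : F C by exact: relative_clopensT.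
have Fcl D : F D -> closed D by case.
have FI D E : F D -> F E -> F (D `&` E) by exact: relative_clopensI.
have : nbhs x (C `&` W) by exact: filterI.
rewrite nbhsE => -[N [oN Nx] NCW].
have [|D [Dx cD cD' DC] DN] := compact_bigcap_sub_open cC oN FC FI Fcl.
  move=> y Qy; suff -> : y = x by [].
  suff : connected_component [set: G] x y by rewrite G_td.
  exists (\bigcap_(D in F) D) => //; split=> //; first by move=> D [].
  exact: quasicomponent_connected.
exists D; split=> //; first exact: subclosed_compact DC.
  have -> : D = N `&` ~` (C `\` D).
    apply/seteqP; split=> y.
      by move=> Dy; split; [exact: DN|move=> []].
    move=> [Ny nCD]; apply: contrapT => nDy; apply: nCD; split=> //.
    by case: (NCW y Ny).
  by apply: openI => //; exact: closed_openC.
by move=> y /DN /NCW [].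
Qed.

(** The stabiliser of a compact open neighbourhood V of 1, for left
    multiplication, lies in V because 1 does, and it is open by the tube
    lemma. *)
Theorem van_dantzig W :
  nbhs 1 W -> exists2 U, compact_open_subgroup U & U `<=` W.
Proof.
move=> /compact_open_nbhs [V [cV oV V1 VW]].
pose H := [set g | forall x, V (g * x) <-> V x].
have sH : is_subgroup H.
  split; first by move=> x; rewrite mul1g.
    by move=> g h Hg Hh x; rewrite -mulgA; split=> [/Hg /Hh|/Hh /Hg].
  by move=> g Hg x; rewrite -(Hg (g^-1 * x)) mulVKg.
have HV : H `<=` V by move=> g /(_ 1); rewrite mulg1 => ->.
have [N [oN N1 NV]] := mulg_tube_l cV oV (@subset_refl _ V).
have oH : open H.
  have [N' [oN' N'1 NN']] := open_divg oN N1.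
  have -> : H = set_mulg H N'; last exact: open_mulg.
  apply/seteqP; split=> [y nHy|_ [y Hy [h Hh <-]]].
    by exists y => //; exists 1 => //; rewrite mulg1.
  case: sH => _ HM _; apply: HM => // x; split=> Vx.
    rewrite -(mulKg h x); apply: NV; exists h^-1; last by exists (h * x).
    by rewrite -[h^-1]mul1g; apply: NN'.
  apply: NV; exists h; last by exists x.
  by rewrite -[h]mulg1 -invg1; apply: NN'.
exists H; last exact: subset_trans VW.
split=> //; apply: (subclosed_compact _ cV) => //.
exact: open_subgroup_closed.
Qed.

Lemma exists_compact_open_subgroup : exists U : set G, compact_open_subgroup U.
Proof.
by have [|U coU _] := van_dantzig (W := setT); [exact: filterT|exists U].
Qed.

Lemma compact_open_between K W : compact K -> open W -> K `<=` W ->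
  exists P, [/\ compact P, open P, K `<=` P & P `<=` W].
Proof.
move=> cK oW KW; have [N [oN N1 NW]] := mulg_tube cK oW KW.
have [|V [[V1 _ _] cV oV] VN] := van_dantzig (W := N).
  exact: open_nbhs_nbhs.
exists (set_mulg K V); split; [exact: compact_mulg|exact: open_mulg| |].
  by move=> x Kx; exists x => //; exists 1%g => //; rewrite mulg1.
by apply: subset_trans NW; exact: set_mulgS.
Qed.

End VanDantzig.

(** * Counting cosets *)

(** Maps whose fibres are the left cosets of a subgroup H.  Two of them matter:
    orbit maps of actions, with H a stabiliser, and the map sending g to its
    left coset. *)
Section CosetFibres.
Local Open Scope classical_set_scope.
Local Open Scope group_scope.
Variables (G : topologicalGroupType) (T : choiceType).
Variables (f : G -> T) (H : set G).
Implicit Types (A K : set G) (B : set T) (g h x : G).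
Hypothesis fibP : forall g h, f g = f h <-> H (g^-1 * h).

Lemma fibreE g : f @^-1` [set f g] = set_mulg [set g] H.
Proof.
rewrite set_mulg1E; apply/seteqP; split=> x /=; first by move=> /esym /fibP.
by move=> /fibP.
Qed.

Lemma fibre_cases (t : T) : f @^-1` [set t] = set0 \/
  exists2 g, f g = t & f @^-1` [set t] = set_mulg [set g] H.
Proof.
have [[g gt]|ng] := pselect (exists g, f g = t); last first.
  by left; rewrite -subset0 => g gt; apply: ng; exists g.
by right; exists g => //; rewrite -gt fibreE.
Qed.

Lemma preimage_bigcup_fibres B :
  f @^-1` B = \bigcup_(t in B) f @^-1` [set t].
Proof. by apply/seteqP; split=> [x Bx|x [t Bt /= ->//]]; exists (f x). Qed.

Lemma open_fibres B : open H -> open (f @^-1` B).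
Proof.
move=> oH; rewrite preimage_bigcup_fibres; apply: bigcup_open => t _.
case: (fibre_cases t) => [->|[g _ ->]]; first exact: open0.
exact: open_ltranslate.
Qed.

Lemma finite_image_compact K : open H -> compact K -> finite_set (f @` K).
Proof.
move=> oH; rewrite compact_cover.
move=> /(_ T (f @` K) (fun t => f @^-1` [set t])) [].
- by move=> t _; exact: open_fibres.
- by move=> x Kx; exists (f x) => //; exists x.
- move=> D _ KD; apply: (sub_finite_set _ (finite_fset D)).
  by move=> _ [x /KD [t Dt /= ->] <-].
Qed.

Lemma compact_fibres B : compact H -> finite_set B -> compact (f @^-1` B).
Proof.
move=> cH fB; rewrite preimage_bigcup_fibres.
rewrite -bigsetU_fset_set //; apply: bigsetU_compact => t _.
case: (fibre_cases t) => [->|[g _ ->]]; first exact: compact0.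
by apply: compact_mulg => //; exact: compact_set1.
Qed.

End CosetFibres.

Section LeftCosets.
Local Open Scope classical_set_scope.
Local Open Scope group_scope.
Variable (G : topologicalGroupType) (H : set G).
Hypothesis sH : is_subgroup H.

Definition left_coset (g : G) : set G := set_mulg [set g] H.

Lemma left_cosetP g h : left_coset g = left_coset h <-> H (g^-1 * h).
Proof.
case: sH => H1 HM HV; rewrite /left_coset !set_mulg1E; split=> [e|Hgh].
  have : ((fun x => h^-1 * x) @^-1` H) h by rewrite /= mulVg.
  by rewrite -e.
apply/seteqP; split=> x /= Hx.
  have -> : h^-1 * x = (g^-1 * h)^-1 * (g^-1 * x).
    by rewrite invgM invgK mulgA mulgK.
  by apply: HM => //; exact: HV.
have -> : g^-1 * x = (g^-1 * h) * (h^-1 * x) by rewrite mulgA mulgK.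
exact: HM.
Qed.

End LeftCosets.

(** * Haar measure of a totally disconnected group *)

Section LeftInvariantContents.
Local Open Scope ring_scope.
Local Open Scope classical_set_scope.
Local Open Scope group_scope.
Local Open Scope ereal_scope.
Variables (R : realType) (G : topologicalGroupType).
Implicit Types (A B H : set G) (g h : G).

(** Only the values on open sets are constrained, so that images of a Haar
    measure under homeomorphisms qualify without being packaged as measures. *)
Record left_content (nu : set G -> \bar R) : Prop := {
  content_set0 : nu set0 = 0;
  content_additive : forall A B, open A -> open B -> A `&` B = set0 ->
    nu (A `|` B) = nu A + nu B;
  content_invariant : forall g A, open A -> nu (set_mulg [set g] A) = nu A
}.

Lemma content_fibres (T : choiceType) (f : G -> T) H (nu : set G -> \bar R)
    (B : set T) :
  left_content nu -> open H -> (forall g h, f g = f h <-> H (g^-1 * h)%g) ->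
  finite_set B -> B `<=` range f ->
  nu (f @^-1` B) = (#|` fset_set B|)%:R%:E * nu H.
Proof.
move=> cnu oH fibP finB Bf; rewrite -{1}(fset_setK finB).
have : [set` fset_set B] `<=` range f by rewrite fset_setK.
move: (fset_uniq (fset_set B)).
have -> : [set` fset_set B] = [set` (fset_set B : seq T)].
  by apply/seteqP; split=> x.
rewrite (cardfE (fset_set B)) -cardfE.
elim: {B finB Bf} (enum_fset (fset_set B)) => [_ _|t s IH /=].
  by rewrite mul0e -(content_set0 cnu); congr nu; apply/seteqP; split.
move=> /andP[ts us] sf.
have [g _ gt] : range f t by apply: sf; rewrite /= mem_head.
have -> : f @^-1` [set` t :: s] = f @^-1` [set t] `|` f @^-1` [set` s].
  apply/seteqP; split=> x /=; rewrite inE.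
    by move=> /orP[/eqP|]; [left|right].
  by move=> [->|->]; rewrite ?eqxx ?orbT.
rewrite (content_additive cnu).
- rewrite IH //; last by move=> u us'; apply: sf; rewrite /= inE us' orbT.
  rewrite -gt (fibreE fibP) (content_invariant cnu) //.
  by rewrite -natr1 EFinD ge0_muleDl ?lee_fin // mul1e addeC.
- exact: (open_fibres fibP).
- exact: (open_fibres fibP).
- by rewrite -subset0 => x [/= -> ]; apply/negP.
Qed.

End LeftInvariantContents.

Section Haar.
Local Open Scope ring_scope.
Local Open Scope classical_set_scope.
Local Open Scope group_scope.
Local Open Scope ereal_scope.
Variables (R : realType) (G : topologicalGroupType).
Variable mu : {measure set (borel G) -> \bar R}.
Hypothesis G_td : totally_disconnected [set: G].
Hypothesis G_lc : locally_compact [set: G].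
Hypothesis mu_haar : is_left_haar mu.
Implicit Types (A B K N P Q U V W : set G) (g h x y : G).

Lemma open_measurable_borel A : open A -> measurable (A : set (borel G)).
Proof. by move=> oA; exact: sub_sigma_algebra. Qed.

Lemma compact_measurable_borel A : compact A -> measurable (A : set (borel G)).
Proof.
move=> /(td_compact_closed G_td) cA; rewrite -[A]setCK; apply: measurableC.
by apply: open_measurable_borel; exact: closed_openC.
Qed.

Lemma le_mu A B : measurable (A : set (borel G)) ->
  measurable (B : set (borel G)) -> A `<=` B -> mu A <= mu B.
Proof. by move=> mA mB AB; apply: le_measure => //; rewrite inE. Qed.

Lemma haar_content : left_content (fun A => mu A).
Proof.
split; first exact: measure0.
  by move=> A B oA oB AB; apply: measureU => //; exact: open_measurable_borel.
move=> g A oA; apply: (haar_left_invariant mu_haar).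
exact: open_measurable_borel.
Qed.

Lemma haar_fineE K : compact K -> mu K = (fine (mu K))%:E.
Proof.
by move=> cK; rewrite fineK // ge0_fin_numE //; exact: (haar_compact mu_haar).
Qed.

(** If H is null, so is every compact set, being covered by finitely many cosets
    of H, and then the measure vanishes by inner regularity. *)
Lemma haar_subgroup_gt0 H : compact_open_subgroup H -> 0 < mu H.
Proof.
move=> [sH cH oH]; rewrite lt0e measure_ge0 andbT; apply/eqP => muH0.
apply: (haar_neq0 mu_haar).
rewrite (haar_inner_regular mu_haar); last exact: openT.
apply/eqP; rewrite eq_le; apply/andP; split; last first.
  apply: ereal_sup_ubound; exists set0; last exact: measure0.
  by split=> //; exact: compact0.
apply: ge_ereal_sup => _ [K [cK _] <-].
have fK := finite_image_compact (left_cosetP sH) oH cK.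
have -> : 0 = mu (left_coset H @^-1` (left_coset H @` K)).
  rewrite (content_fibres haar_content oH (left_cosetP sH)) ?muH0 ?mule0 //.
  by move=> _ [x _ <-]; exists x.
apply: le_mu; first exact: compact_measurable_borel.
  by apply: open_measurable_borel; exact: (open_fibres (left_cosetP sH)).
by move=> x Kx; exists x.
Qed.

Lemma haar_subgroupE H : compact_open_subgroup H ->
  exists2 r : R, (0 < r)%R & mu H = r%:E.
Proof.
move=> coH; have := haar_subgroup_gt0 coH; case: coH => _ cH _.
by rewrite haar_fineE // lte_fin; exists (fine (mu H)).
Qed.

Lemma haar_open_gt0 W x : open W -> W x -> 0 < mu W.
Proof.
move=> oW Wx.
have [|H coH HW] := van_dantzig G_td G_lc (W := set_mulg [set x^-1%g] W).
  apply: open_nbhs_nbhs; split; first exact: open_ltranslate.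
  by exists x^-1%g => //; exists x => //; rewrite mulVg.
rewrite -(content_invariant haar_content x^-1%g oW).
apply: lt_le_trans (haar_subgroup_gt0 coH) _; case: coH => _ _ oH.
apply: le_mu => //; first exact: open_measurable_borel.
by apply: open_measurable_borel; exact: open_ltranslate.
Qed.

(** The image of mu under a homeomorphism phi of G, with inverse psi, assumed to
    be left invariant on open sets. *)
Section Transport.
Variables (phi psi : G -> G).
Hypotheses (phi_cont : continuous phi) (psi_cont : continuous psi).
Hypotheses (phiK : cancel phi psi) (psiK : cancel psi phi).
Let nu A := mu (psi @^-1` A).
Hypothesis nu_inv :
  forall g A, open A -> nu (set_mulg [set g] A) = nu A.

Let open_psi A : open A -> open (psi @^-1` A).
Proof. by move=> oA; apply: open_comp => // x _; exact: psi_cont. Qed.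

Let compact_psi A : compact A -> compact (psi @^-1` A).
Proof.
move=> cA; have -> : psi @^-1` A = phi @` A.
  apply/seteqP; split=> [x Ax|_ [y Ay <-]]; first by exists (psi x).
  by rewrite /= phiK.
by apply: continuous_compact => //; exact: continuous_subspaceT.
Qed.

Let measurable_psi A : measurable (A : set (borel G)) ->
  measurable (psi @^-1` A : set (borel G)).
Proof.
move=> mA; rewrite -[_ @^-1` _]setTI.
have : @measurable_fun _ _ (borel G) (borel G) setT psi.
  apply: (@measurability _ _ (borel G) (borel G) setT psi (@open G)) => //.
  move=> _ [B oB <-]; rewrite setTI; apply: open_measurable_borel.
  exact: open_psi.
by apply.
Qed.

Let nu_content : left_content nu.
Proof.
split => //.
move=> A B oA oB AB; rewrite /nu preimage_setU measureU //.
- by apply: open_measurable_borel; exact: open_psi.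
- by apply: open_measurable_borel; exact: open_psi.
- by rewrite -preimage_setI AB preimage_set0.
Qed.

(** P and Q are finite unions of left cosets of a single compact open subgroup
    V, and both contents give all cosets of V the same value. *)
Lemma haar_transport_compact_open P Q :
  compact_open_subgroup Q -> compact P -> open P ->
  nu P * mu Q = mu P * nu Q.
Proof.
move=> [sQ cQ oQ] cP oP.
have [N [oN N1 NP]] := mulg_tube cP oP (@subset_refl _ P).
have [|V [sV cV oV] VNQ] := van_dantzig G_td G_lc (W := N `&` Q).
  by apply: open_nbhs_nbhs; split; [exact: openI|split=> //; case: sQ].
have fibP := left_cosetP sV.
have saturated X : (forall x v, X x -> V v -> X (x * v)%g) ->
    X = left_coset V @^-1` (left_coset V @` X).
  move=> XV; apply/seteqP; split=> [x Xx|x [y Xy /fibP Vyx]]; first by exists x.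
  by rewrite -(mulVKg y x); apply: XV.
have EP : P = left_coset V @^-1` (left_coset V @` P).
  apply: saturated => x v Px /VNQ[Nv _].
  by apply: NP; exists x => //; exists v.
have EQ : Q = left_coset V @^-1` (left_coset V @` Q).
  by apply: saturated => x v Qx /VNQ[_ Qv]; case: sQ => _ QM _; exact: QM.
have count (n : set G -> \bar R) X : left_content n -> compact X ->
    X = left_coset V @^-1` (left_coset V @` X) ->
    n X = (#|` fset_set (left_coset V @` X)|)%:R%:E * n V.
  move=> cn cX EX; rewrite {1}EX (content_fibres cn oV fibP) //.
    exact: (finite_image_compact fibP oV cX).
  by move=> _ [x _ <-]; exists x.
rewrite (count _ _ nu_content cP EP) (count _ _ haar_content cQ EQ).
rewrite (count _ _ nu_content cQ EQ) (count _ _ haar_content cP EP).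
move: (nu V) (mu V) => a b; rewrite -!muleA; congr mule.
by rewrite muleCA [a * b]muleC muleCA.
Qed.

(** Uniqueness of Haar measure, for measures of the form nu.  Proportionality
    passes from compact open sets to open sets, since these form a cofinal
    family among the compact subsets of an open set, and then to Borel sets by
    outer regularity. *)
Theorem haar_transport_unique Q : compact_open_subgroup Q ->
  exists c : R, [/\ (0 < c)%R, nu Q = c%:E * mu Q &
    (forall A, measurable (A : set (borel G)) -> nu A = c%:E * mu A)].
Proof.
move=> coQ; have [q q0 qE] := haar_subgroupE coQ.
have [sQ cQ oQ] := coQ.
have Q1 : Q 1%g by case: sQ.
have nuQE : nu Q = (fine (nu Q))%:E by apply: haar_fineE; exact: compact_psi.
have nuQ0 : (0 < fine (nu Q))%R.
  rewrite -lte_fin -nuQE; apply: (@haar_open_gt0 _ (phi 1%g)).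
    exact: open_psi.
  by rewrite /= phiK.
set n := fine (nu Q) in nuQE nuQ0.
pose c := (n / q)%R; have c0 : (0 < c)%R by rewrite divr_gt0.
have nuP P : compact P -> open P -> nu P = c%:E * mu P.
  move=> cP oP; have := haar_transport_compact_open coQ cP oP.
  rewrite qE nuQE => /(congr1 (fun e => e * (q^-1)%:E)).
  rewrite -!muleA -!EFinM divff ?gt_eqF // mule1 => ->.
  by rewrite muleC.
have nuW W : open W -> nu W = c%:E * mu W.
  move=> oW; apply/eqP; rewrite eq_le; apply/andP; split.
    rewrite /nu (haar_inner_regular mu_haar (open_psi oW)).
    apply: ge_ereal_sup => _ [K [cK KW] <-].
    have cK' : compact (psi @` K).
      by apply: continuous_compact => //; exact: continuous_subspaceT.
    have [|P [cP oP KP PW]] := compact_open_between G_td G_lc cK' oW.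
      by move=> _ [x Kx <-]; exact: KW.
    have KP' : mu K <= nu P.
      apply: le_mu; first exact: compact_measurable_borel.
        by apply: open_measurable_borel; apply: open_psi.
      by move=> x Kx; apply: KP; exists x.
    apply: le_trans KP' _; rewrite nuP // lee_pmul2l // ?lte_fin //.
    by apply: le_mu => //; exact: open_measurable_borel.
  rewrite -lee_pdivlMl // (haar_inner_regular mu_haar oW).
  apply: ge_ereal_sup => _ [K [cK KW] <-]; rewrite lee_pdivlMl //.
  have [P [cP oP KP PW]] := compact_open_between G_td G_lc cK oW KW.
  apply: (@le_trans _ _ (nu P)).
    rewrite nuP // lee_pmul2l ?lte_fin //; apply: le_mu => //.
      exact: compact_measurable_borel.
    exact: open_measurable_borel.
  apply: le_mu; try by apply: open_measurable_borel; apply: open_psi.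
  by move=> x /PW.
exists c; split => //; first by rewrite nuP.
move=> A mA; apply/eqP; rewrite eq_le; apply/andP; split.
  rewrite -lee_pdivrMl // (haar_outer_regular mu_haar mA).
  apply: le_ereal_inf_tmp => _ [W [oW AW] <-]; rewrite lee_pdivrMl // -nuW //.
  apply: le_mu; first exact: measurable_psi.
    by apply: open_measurable_borel; apply: open_psi.
  by move=> x /AW.
rewrite /nu (haar_outer_regular mu_haar (measurable_psi mA)).
apply: le_ereal_inf_tmp => _ [W [oW AW] <-].
have oW' : open (phi @^-1` W) by apply: open_comp => // x _; exact: phi_cont.
have -> : W = psi @^-1` (phi @^-1` W).
  by apply/seteqP; split=> x /=; rewrite psiK.
rewrite -/(nu _) nuW // lee_pmul2l ?lte_fin //.
apply: le_mu => //; first exact: open_measurable_borel.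
by move=> x Ax /=; apply: AW; rewrite /= phiK.
Qed.

End Transport.

(** * Amenability and unimodularity *)

(** The image of the Haar measure under right translation by g is left
    invariant, hence a multiple of it, so modular mu g is not the default value
    of its definition. *)
Lemma modularP g : (0 < modular mu g)%R /\
  forall A, measurable (A : set (borel G)) ->
    mu (set_mulg A [set g]) = (modular mu g)%:E * mu A.
Proof.
have [Q coQ] := exists_compact_open_subgroup G_td G_lc.
have [||||h A oA|c [c0 cQ cA]] := @haar_transport_unique
  (fun x => x * g)%g (fun x => x * g^-1)%g _ _ _ _ _ Q coQ.
- exact: rmul_continuous.
- exact: rmul_continuous.
- by move=> x; rewrite mulgK.
- by move=> x; rewrite mulgVK.
- have -> : (fun x => x * g^-1)%g @^-1` set_mulg [set h] A =
            set_mulg [set h] ((fun x => x * g^-1)%g @^-1` A).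
    by rewrite !set_mulg1E; apply/seteqP; split=> x /=; rewrite mulgA.
  apply: (content_invariant haar_content).
  by rewrite -set_mulgE1; exact: open_rtranslate.
suff -> : modular mu g = c by split=> // A mA; rewrite set_mulgE1 cA.
apply: xget_unique; first by split=> // A mA; rewrite set_mulgE1 cA.
move=> r [r0 rA]; have [_ _ oQ] := coQ; have mQ := open_measurable_borel oQ.
have := rA Q mQ; rewrite set_mulgE1 cA //.
have [q q0 ->] := haar_subgroupE coQ.
by rewrite -!EFinM => -[] /mulIf -> //; rewrite gt_eqF.
Qed.

Lemma le_haar_ratio U (X : \bar R) (e : R) : compact U -> 0 < mu U ->
  (X / mu U <= e%:E) = (X <= e%:E * mu U).
Proof.
move=> cU; rewrite (haar_fineE cU) lte_fin => q0.
by rewrite inver gt_eqF // lee_pdivrMr.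
Qed.

(** A right Folner set U for [set g] satisfies
    Delta(g) mu(U) = mu(Ug) <= (1 + e) mu(U), so Delta(g) <= 1 for all g;
    conclude with Delta(g) Delta(g^-1) = 1. *)
Lemma geometrically_amenable_unimodular :
  geometrically_amenable_group mu -> unimodular mu.
Proof.
move=> gam; have le1 g : (modular mu g <= 1)%R.
  apply/ler_addgt0Pr => e e0.
  have [U [cU U0]] := gam _ (@compact_set1 _ g) e e0.
  have [m0 mE] := modularP g; rewrite le_haar_ratio //.
  rewrite mE; last exact: compact_measurable_borel.
  move: U0; rewrite (haar_fineE cU) lte_fin => q0.
  by rewrite -!EFinM lee_fin ler_pM2r.
move=> g; apply/eqP; rewrite eq_le le1 /=.
have [Q coQ] := exists_compact_open_subgroup G_td G_lc; have [_ _ oQ] := coQ.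
have [m0 mE] := modularP g; have [m0' mE'] := modularP g^-1%g.
have : mu Q = (modular mu g^-1%g)%:E * ((modular mu g)%:E * mu Q).
  rewrite -mE; last exact: open_measurable_borel.
  rewrite -mE'; last by apply: open_measurable_borel; exact: open_rtranslate.
  congr (mu _); rewrite !set_mulgE1; apply/seteqP.
  by split=> x /=; rewrite invgK mulgK.
have [q q0 ->] := haar_subgroupE coQ.
rewrite -!EFinM mulrA => -[] /(congr1 (fun z => z / q)%R).
rewrite mulfK ?gt_eqF // divff ?gt_eqF // => ->.
by rewrite ler_piMl // ltW.
Qed.

Local Notation ginv := (fun x : G => x^-1)%g.

Lemma preimage_invg_mulg A B :
  ginv @^-1` (set_mulg A B) = set_mulg (ginv @^-1` B) (ginv @^-1` A).
Proof.
apply/seteqP; split=> [x [a Aa [b Bb abx]]|_ [b Bb [a Aa <-]]] /=.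
  exists b^-1%g; rewrite /= ?invgK //; exists a^-1%g; rewrite /= ?invgK //.
  by rewrite -invgM abx invgK.
by rewrite invgM; exists a^-1%g => //; exists b^-1%g.
Qed.

Lemma preimage_invgK A : ginv @^-1` (ginv @^-1` A) = A.
Proof. by apply/seteqP; split=> x /=; rewrite invgK. Qed.

(** In a unimodular group the image of mu under inversion is left invariant, so
    it is a multiple of mu, and a compact open subgroup, being stable under
    inversion, shows that the factor is 1. *)
Lemma unimodular_haar_invg A : unimodular mu ->
  measurable (A : set (borel G)) -> mu (ginv @^-1` A) = mu A.
Proof.
move=> um mA; have [Q coQ] := exists_compact_open_subgroup G_td G_lc.
have [||||h B oB|c [c0 cQ cA]] := @haar_transport_unique
  ginv ginv _ _ _ _ _ Q coQ.
- exact: invg_continuous.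
- exact: invg_continuous.
- exact: invgK.
- exact: invgK.
- rewrite preimage_invg_mulg; have [_] := modularP h^-1%g; rewrite um => mE.
  have -> : ginv @^-1` [set h] = [set h^-1%g].
    by apply/seteqP; split=> [x /= <-|_ ->] /=; rewrite invgK.
  rewrite mE ?mul1e //; apply: open_measurable_borel.
  by apply: open_comp => // x _; exact: invg_continuous.
rewrite cA //; suff -> : c = 1%R by rewrite mul1e.
have [[Q1 QM QV] _ _] := coQ.
have [q q0 qE] := haar_subgroupE coQ.
move: cQ; have -> : ginv @^-1` Q = Q.
  by apply/seteqP; split=> x /=; [move=> /QV; rewrite invgK|exact: QV].
rewrite qE -EFinM => -[] /(congr1 (fun z => z / q)%R).
by rewrite mulfK ?gt_eqF // divff ?gt_eqF.
Qed.

Lemma unimodular_amenableP : unimodular mu ->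
  amenable_group mu <-> geometrically_amenable_group mu.
Proof.
have muV U : unimodular mu -> compact U -> mu (ginv @^-1` U) = mu U.
  move=> um cU; apply: unimodular_haar_invg => //.
  exact: compact_measurable_borel.
have cV := compact_preimage_invg.
(* Both directions replace K and the Folner set by their inverses. *)
move=> um; split=> am K cK e e0;
  have [U [cU U0]] := am _ (cV _ _ cK) e e0; rewrite le_haar_ratio // => le;
  (exists (ginv @^-1` U); split; [exact: cV|by rewrite muV|]);
  rewrite le_haar_ratio ?muV //; try exact: cV;
  rewrite -[K]preimage_invgK -preimage_invg_mulg muV //;
  by apply: compact_mulg => //; exact: cV.
Qed.

Theorem amenable_unimodular_geometric :
  amenable_group mu /\ unimodular mu <-> geometrically_amenable_group mu.
Proof.
split=> [[am um]|gam]; first by apply/(unimodular_amenableP um).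
have um := geometrically_amenable_unimodular gam.
by split=> //; apply/(unimodular_amenableP um).
Qed.

End Haar.

(** * Finite sets of vertices *)

Section FiniteCardinals.
Local Open Scope classical_set_scope.
Variable T : choiceType.
Implicit Types A B : set T.

Definition ncard A : nat := #|` fset_set A|.

Lemma ncardS A B : finite_set B -> A `<=` B -> (ncard A <= ncard B)%N.
Proof.
move=> fB AB; have fA := sub_finite_set AB fB.
apply: fsubset_leq_card; apply/fsubsetP => x.
by rewrite !in_fset_set // !inE => /AB.
Qed.

Lemma ncardU A B : finite_set A -> finite_set B ->
  (ncard (A `|` B) <= ncard A + ncard B)%N.
Proof. by move=> fA fB; rewrite /ncard fset_setU // cardfsU leq_subr. Qed.

Lemma ncard_gt0 A : finite_set A -> A !=set0 -> (0 < ncard A)%N.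
Proof.
move=> fA [x Ax]; rewrite /ncard cardfs_gt0; apply/fset0Pn; exists x.
by rewrite in_fset_set // inE.
Qed.

Lemma ncard_bigcup (I : eqType) (s : seq I) (F : I -> set T) A :
  finite_set A -> (forall x, A x -> exists2 i, i \in s & F i x) ->
  (ncard A <= \sum_(i <- s) ncard (A `&` F i))%N.
Proof.
elim: s A => [|i s IH] A fA cov.
  rewrite big_nil leqn0 /ncard cardfs_eq0; apply/eqP; rewrite -fset_set0.
  by congr fset_set; rewrite -subset0 => x /cov[].
rewrite big_cons.
have fAF : finite_set (A `&` F i) by apply: sub_finite_set fA => x [].
have fAD : finite_set (A `\` F i) by apply: sub_finite_set fA => x [].
apply: (@leq_trans (ncard (A `&` F i) + ncard (A `\` F i))).
  by rewrite -{1}(setUIDK A (F i)) ncardU.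
rewrite leq_add2l; apply: leq_trans (IH _ fAD _) _.
  move=> x [/cov[j]]; rewrite inE => /predU1P[-> //|js] Fjx _.
  by exists j.
apply: leq_sum => j _; apply: ncardS; last by move=> x [[]].
by apply: sub_finite_set fA => x [].
Qed.

Lemma sum_ncard_fibres (J : choiceType) (rep : T -> J) A (s : seq J) :
  finite_set A -> uniq s ->
  (\sum_(j <- s) ncard (A `&` [set x | rep x = j]) <= ncard A)%N.
Proof.
elim: s A => [|j s IH] A fA /=; first by rewrite big_nil.
move=> /andP[js us]; rewrite big_cons.
have fAj : finite_set [set x | A x /\ rep x = j].
  by apply: sub_finite_set fA => x [].
have fAD : finite_set (A `\` [set x | rep x = j]).
  by apply: sub_finite_set fA => x [].
rewrite -[in leqRHS](setUIDK A [set x | rep x = j]) /ncard fset_setU //.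
rewrite cardfsU -fset_setI // setDE setIACA setICr setI0 fset_set0 cardfs0.
rewrite subn0 leq_add2l -setDE; apply: leq_trans (IH _ fAD us).
rewrite big_seq [leqRHS]big_seq; apply: leq_sum => k ks; apply: ncardS.
  by apply: sub_finite_set fAD => x [].
move=> x [Ax rk]; split=> //; split=> //= rj.
by move: js; rewrite -rj rk ks.
Qed.

(** If the inequality failed in every fibre that meets A, then summing over
    these fibres would contradict the inequality between Z and A. *)
Lemma pigeonhole_fibre (R : realType) (J : choiceType) (rep : T -> J) A Z
    (e : R) :
  (0 <= e)%R -> finite_set A -> finite_set Z -> A !=set0 ->
  ((ncard Z)%:R <= e * (ncard A)%:R)%R ->
  exists2 x, A x & ((ncard (Z `&` [set y | rep y = rep x]))%:R
                   <= e * (ncard (A `&` [set y | rep y = rep x]))%:R)%R.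
Proof.
move=> e0 fA fZ [x0 Ax0] le; apply: contrapT => nex.
pose I := undup [seq rep x | x <- fset_set A].
have repI x : A x -> rep x \in I.
  move=> Ax; rewrite mem_undup; apply/mapP; exists x => //.
  by rewrite in_fset_set // inE.
have lt j : j \in I -> (e * (ncard (A `&` [set y | rep y = j]))%:R <
    (ncard (Z `&` [set y | rep y = j]))%:R)%R.
  rewrite mem_undup => /mapP[x xA ->]; rewrite ltNge; apply/negP => le'.
  by apply: nex; exists x => //; move: xA; rewrite in_fset_set // inE.
have cov x : A x -> exists2 j, j \in I & [set y | rep y = j] x.
  by move=> Ax; exists (rep x) => //; exact: repI.
move: le; apply/negP; rewrite -ltNge.
apply: (@lt_le_trans _ _
  (\sum_(j <- I) (ncard (Z `&` [set y | rep y = j]))%:R)%R).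
  apply: (@le_lt_trans _ _
    (\sum_(j <- I) e * (ncard (A `&` [set y | rep y = j]))%:R)%R).
    rewrite -mulr_sumr ler_wpM2l // -natr_sum ler_nat.
    exact: ncard_bigcup.
  rewrite (big_rem _ (repI _ Ax0)) [ltRHS](big_rem _ (repI _ Ax0)) /=.
  apply: ltr_leD; first exact/lt/repI.
  by rewrite !big_seq; apply: ler_sum => j /mem_rem jI; exact/ltW/lt.
rewrite -natr_sum ler_nat; apply: sum_ncard_fibres => //.
exact: undup_uniq.
Qed.

End FiniteCardinals.

Section Graphs.
Local Open Scope ring_scope.
Local Open Scope classical_set_scope.
Variable Gam : graph.
Implicit Types (x y z : Gam) (X A : set Gam).

(** A finite set with infinite boundary has ratio +oo and cannot approximate a
    zero infimum, so the boundaries on the right may be taken finite. *)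
Lemma amenable_graphP (R : realType) : amenable_graph Gam R <->
  forall e : R, 0 < e -> exists A, [/\ finite_set A, A !=set0,
    finite_set (boundary A) & (ncard (boundary A))%:R <= e * (ncard A)%:R].
Proof.
have ge0 : (0 <= cheeger Gam R)%E.
  apply: le_ereal_inf_tmp => _ [A [fA A0] <-].
  have A1 := ncard_gt0 fA A0.
  rewrite /counting (asboolT fA) inver gt_eqF ?ltr0n //.
  case: ifP => _; last by rewrite gt0_mulye ?lte_fin ?invr_gt0 ?ltr0n ?leey.
  by rewrite lee_fin divr_ge0.
split=> [am e e0|am].
  have : (cheeger Gam R < e%:E)%E by rewrite am lte_fin.
  move=> /ereal_inf_lt [_ [A [fA A0] <-]].
  have A1 := ncard_gt0 fA A0.
  rewrite /counting (asboolT fA) inver gt_eqF ?ltr0n //.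
  case: ifPn => [/asboolP fdA|_]; last first.
    by rewrite gt0_mulye // lte_fin invr_gt0 ltr0n.
  rewrite -EFinM lte_fin ltr_pdivrMr ?ltr0n // => /ltW le.
  by exists A.
apply/eqP; rewrite eq_le ge0 andbT; apply/lee_addgt0Pr => e e0; rewrite add0e.
have [A [fA A0 fdA le]] := am e e0; have A1 := ncard_gt0 fA A0.
apply: ereal_inf_le; exists (counting (boundary A) / counting A)%E.
  by exists A.
rewrite /counting (asboolT fA) (asboolT fdA) inver gt_eqF ?ltr0n //.
by rewrite -EFinM lee_fin ler_pdivrMr ?ltr0n.
Qed.

Lemma finite_boundary A :
  locally_finite_graph Gam -> finite_set A -> finite_set (boundary A).
Proof.
move=> lf fA.
apply: (@sub_finite_set _ _ (\bigcup_(x in A) [set y | adj x y])).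
  by move=> y [_ [x Ax xy]]; exists x.
by apply: bigcup_finite => // x _; exact: lf.
Qed.

Lemma walk_cat n m x y z : walk n x y -> walk m y z -> walk (n + m) x z.
Proof.
elim: n x => [|n IH] x /=; first by move=> ->.
by move=> [t xt ty] yz; exists t => //; exact: IH.
Qed.

Lemma walk_sym n x y : walk n x y -> walk n y x.
Proof.
elim: n x => [|n IH] x /=; first by move=> ->.
move=> [t xt /IH ty]; rewrite -/(walk n.+1 y x) -addn1; apply: (walk_cat ty).
by exists x => //; exact: adj_sym.
Qed.

Definition closed_nbhd X := X `|` \bigcup_(x in X) [set y | adj x y].

Fixpoint thicken n X : set Gam :=
  if n is m.+1 then thicken m (closed_nbhd X) else X.

Lemma thickenS X Y n : X `<=` Y -> thicken n X `<=` thicken n Y.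
Proof.
elim: n X Y => [//|n IH] X Y XY; apply: IH => y [Xy|[x Xx xy]].
  by left; exact: XY.
by right; exists x => //; exact: XY.
Qed.

Lemma thicken_mono m n X : (m <= n)%N -> thicken m X `<=` thicken n X.
Proof.
move=> /subnK <-; elim: (n - m)%N => [//|k IH] x /IH.
by rewrite addSn /=; apply: thickenS => y; left.
Qed.

Lemma thicken_walk n X x y : X x -> walk n x y -> thicken n X y.
Proof.
elim: n X x => [|n IH] X x Xx /=; first by move=> <-.
by move=> [z xz]; apply: IH; right; exists x.
Qed.

(** A walk that leaves A passes through the boundary of A.  So the points
    outside A that are near A are controlled by the boundary, and not merely by
    A. *)
Lemma walk_thicken_boundary n A x y : A x -> walk n x y ->
  A y \/ thicken n (boundary A) y.
Proof.
elim: n x => [|n IH] x Ax /=; first by move=> <-; left.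
move=> [z xz zy]; have [Az|nAz] := pselect (A z).
  have [|ty] := IH z Az zy; first by left.
  by right; apply: (thicken_mono (leqnSn n)).
right; apply: (thicken_mono (leqnSn n)); apply: thicken_walk zy.
by split=> //; exists x.
Qed.

Lemma ncard_closed_nbhd D X : (forall x, ([set y | adj x y] #<= `I_D)%card) ->
  finite_set X ->
  finite_set (closed_nbhd X) /\ (ncard (closed_nbhd X) <= D.+1 * ncard X)%N.
Proof.
move=> degD fX.
have fin x : finite_set [set y | adj x y].
  exact: card_le_finite (degD x) (finite_II D).
have fN : finite_set (closed_nbhd X).
  by rewrite finite_setU; split=> //; apply: bigcup_finite.
split=> //; pose F x := [set x] `|` [set y | adj x y].
have cov y : closed_nbhd X y ->
    exists2 x, x \in (fset_set X : seq Gam) & F x y.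
  move=> [Xy|[x Xx xy]]; last by exists x; [rewrite in_fset_set ?inE|right].
  by exists y; [rewrite in_fset_set ?inE|left].
apply: leq_trans (ncard_bigcup fN cov) _.
rewrite /ncard cardfE -cardfE mulnC -sum1_size big_distrl /=.
apply: leq_sum => x _.
have fF : finite_set (F x).
  by rewrite finite_setU; split=> //; exact: finite_set1.
apply: (@leq_trans (ncard (F x))); first by apply: ncardS => // y [].
apply: leq_trans (ncardU (finite_set1 x) (fin x)) _.
rewrite /ncard fset_set1 cardfs1 mul1n add1n ltnS.
exact: geq_card_fset_set.
Qed.

Lemma ncard_thicken D n X : (forall x, ([set y | adj x y] #<= `I_D)%card) ->
  finite_set X ->
  finite_set (thicken n X) /\ (ncard (thicken n X) <= D.+1 ^ n * ncard X)%N.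
Proof.
move=> degD; elim: n X => [|n IH] X fX /=; first by rewrite expn0 mul1n.
have [fN cN] := ncard_closed_nbhd degD fX.
have [fT cT] := IH _ fN; split=> //.
by apply: leq_trans cT _; rewrite expnSr -mulnA leq_mul2l cN orbT.
Qed.

End Graphs.

(** * Actions on graphs *)

Section PointwiseTopology.
Local Open Scope classical_set_scope.

Lemma ptws_continuousP (G : topologicalGroupType) (T : choiceType)
    (f : G -> T -> T) :
  continuous (f : G -> {ptws T -> discrete_topology T}) <->
  forall g x, \forall h \near g, f h x = f g x.
Proof.
(* pointwise_cvgP speaks of maps between topological spaces; the source gets the
   discrete topology, which does not affect pointwise convergence. *)
pose U := discrete_topology T.
have P g := @pointwise_cvgP U U (f @ g) (f g) _.
split=> [cf g x|cf g].
  have /P /(_ x) := cf g.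
  by move=> /(_ [set f g x] (discrete_set1 (X := U) _)).
apply/P => x B /principal_filterP Bx.
by apply: (filterS _ (cf g x)) => h e; rewrite /= e.
Qed.

End PointwiseTopology.

Section Actions.
Local Open Scope ring_scope.
Local Open Scope classical_set_scope.
Local Open Scope group_scope.
Variables (G : topologicalGroupType) (Gam : graph) (a : graph_action G Gam).
Implicit Types (x y z : Gam) (g h : G) (B : set Gam).

Lemma act_inj g : injective (a g).
Proof.
by move=> x y e; rewrite -[x](act1 a) -[y](act1 a) -(mulVg g) !actM e.
Qed.

Lemma act_walk g n x y : walk n x y -> walk n (a g x) (a g y).
Proof.
elim: n x => [|n IH] x /=; first by move=> ->.
by move=> [z xz zy]; exists (a g z); [apply/act_adj|exact: IH].
Qed.

Lemma orbit_mapP x g h : a g x = a h x <-> stabiliser a x (g^-1 * h).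
Proof.
rewrite /stabiliser /= actM; split=> [<-|e]; first by rewrite -actM mulVg act1.
by apply: (act_inj (g := g^-1)); rewrite e -actM mulVg act1.
Qed.

Lemma stabiliser_subgroup x : is_subgroup (stabiliser a x).
Proof.
split; rewrite /stabiliser /=; first exact: act1.
  by move=> g h gx hx; rewrite actM hx.
by move=> g gx; apply: (act_inj (g := g)); rewrite -actM mulgV act1.
Qed.

Lemma stabiliser_open x : open (stabiliser a x).
Proof.
rewrite openE => g gx; rewrite /interior.
have /ptws_continuousP /(_ g x) := @act_continuous _ _ a.
by apply: filterS => h; rewrite gx.
Qed.

Lemma stabiliser_compact_open x :
  proper_action a -> compact_open_subgroup (stabiliser a x).
Proof.
move=> pa; split; [exact: stabiliser_subgroup|exact: pa|].
exact: stabiliser_open.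
Qed.

Lemma orbit_refl x : orbit_of a x x.
Proof. by exists 1 => //; exact: act1. Qed.

Lemma orbit_eq x y : orbit_of a x y -> orbit_of a x = orbit_of a y.
Proof.
move=> [g _ <-]; apply/seteqP; split=> [_ [h _ <-]|_ [h _ <-]].
  by exists (h * g^-1) => //; rewrite -actM mulgVK.
by exists (h * g) => //; rewrite actM.
Qed.

Lemma orbit_eqP x y : orbit_of a x = orbit_of a y <-> orbit_of a x y.
Proof. by split=> [->|/orbit_eq//]; exact: orbit_refl. Qed.

Lemma quasitransitive_representatives : quasitransitive_action a ->
  exists s : seq Gam, forall y, exists2 x, x \in s & orbit_of a x y.
Proof.
move=> qt.
have /choice [r rP] : forall O, exists x : option Gam, orbits a O ->
    if x is Some x then O = orbit_of a x else False.
  move=> O; have [[x _ <-]|nO] := pselect (orbits a O); last by exists None.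
  by exists (Some x).
exists (pmap r (fset_set (orbits a))) => y.
have oy : orbits a (orbit_of a y) by exists y.
have := rP _ oy; case E : (r _) => [x|] // e; exists x.
  rewrite mem_pmap; apply/mapP; exists (orbit_of a y) => //.
  by rewrite in_fset_set // inE.
by rewrite -e; exact: orbit_refl.
Qed.

Definition transporter x B : set G := [set g | B (a g x)].

Lemma transporterE x B :
  transporter x B = (fun g => a g x) @^-1` (B `&` orbit_of a x).
Proof.
apply/seteqP; split=> g; last by case.
by move=> Bg; split=> //; exists g.
Qed.

Lemma transporter_open x B : open (transporter x B).
Proof.
rewrite transporterE; apply: (open_fibres (orbit_mapP x)).
exact: stabiliser_open.
Qed.

Lemma transporter_compact x B :
  proper_action a -> finite_set B -> compact (transporter x B).
Proof.
move=> pa fB; rewrite transporterE.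
apply: (compact_fibres (orbit_mapP x)); first exact: pa.
by apply: sub_finite_set fB => y [].
Qed.

Lemma haar_transporter (R : realType) (mu : {measure set (borel G) -> \bar R})
    x B : is_left_haar mu -> finite_set B ->
  mu (transporter x B) =
    ((ncard (B `&` orbit_of a x))%:R%:E * mu (stabiliser a x))%E.
Proof.
move=> mu_haar fB; rewrite transporterE.
rewrite (content_fibres (haar_content mu_haar) (stabiliser_open x)
  (orbit_mapP x)) //.
by apply: sub_finite_set fB => y [].
Qed.

End Actions.

(** * From Folner sets of the group to amenable graphs *)

Section FolnerToGraph.
Local Open Scope ring_scope.
Local Open Scope classical_set_scope.
Local Open Scope group_scope.
Local Open Scope ereal_scope.
Variables (R : realType) (G : topologicalGroupType).
Variable mu : {measure set (borel G) -> \bar R}.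
Hypothesis G_td : totally_disconnected [set: G].
Hypothesis G_lc : locally_compact [set: G].
Hypothesis mu_haar : is_left_haar mu.
Variables (Gam : graph) (a : graph_action G Gam).
Hypothesis pa : proper_action a.
Implicit Types (K L : set G) (g h : G) (A : set Gam).

(** Multiplied by the measure of the stabiliser of x, the left-hand side is the
    measure of a subset of LK that is disjoint from L, hence at most e mu(L),
    and mu(L) is in turn at most the measure of the set of g with g x in A. *)
Lemma ncard_boundary_orbit A K L x (e : R) : (0 <= e)%R ->
  finite_set A -> finite_set (boundary A) ->
  compact K -> compact L -> K 1%g ->
  (forall g, L g -> A (a g x)) ->
  (forall h, boundary A (a h x) -> exists2 g, L g & K (g^-1 * h)%g) ->
  mu (set_mulg L K) <= (1 + e)%:E * mu L ->
  ((ncard (boundary A `&` orbit_of a x))%:R <= e * (ncard A)%:R)%R.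
Proof.
move=> e_ge0 fA fdA cK cL K1 LA dALK le.
have cLK : compact (set_mulg L K) by exact: compact_mulg.
pose E := transporter a x (boundary A); pose F := transporter a x A.
have oE : open E by exact: transporter_open.
have oF : open F by exact: transporter_open.
have mL := compact_measurable_borel G_td cL.
have mLK := compact_measurable_borel G_td cLK.
have ELK : E `|` L `<=` set_mulg L K.
  move=> h [/dALK[g Lg Kgh]|Lh].
    by exists g => //; exists (g^-1 * h)%g => //; rewrite mulVKg.
  by exists h => //; exists 1%g => //; rewrite mulg1.
have EL0 : E `&` L = set0.
  by rewrite -subset0 => h [[nAh _] Lh]; apply: nAh; exact: LA.
have mE := open_measurable_borel oE.
have : mu E + mu L <= (1 + e)%:E * mu L.
  rewrite -measureU //; apply: le_trans le; apply: le_mu => //.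
  exact: measurableU.
have [q q0 qE] := haar_subgroupE G_td mu_haar (stabiliser_compact_open x pa).
have [l lE] : exists l, mu L = l%:E.
  by exists (fine (mu L)); exact: (haar_fineE mu_haar cL).
have : mu L <= mu F.
  by apply: le_mu => //; exact: open_measurable_borel.
rewrite lE !(haar_transporter _ _ mu_haar) // qE.
rewrite -!EFinM -EFinD !lee_fin => lF.
rewrite mulrDl mul1r [X in (_ <= X)%R]addrC lerD2r => Ee.
rewrite -(ler_pM2r q0); apply: le_trans Ee _; rewrite -mulrA ler_wpM2l //.
apply: le_trans lF _; rewrite ler_pM2r // ler_nat.
by apply: ncardS => // y [].
Qed.

(** A right Folner set L for the elements that move an orbit representative next
    to another one is carried by the orbit maps to a finite set of vertices; its
    boundary is small in each of the finitely many orbits. *)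
Theorem geometric_to_graph : geometrically_amenable_group mu ->
  [set: Gam] !=set0 -> locally_finite_graph Gam -> quasitransitive_action a ->
  amenable_graph Gam R.
Proof.
move=> gam [x0 _] lf /quasitransitive_representatives [s sP].
have [z0 z0s _] := sP x0.
pose K := [set 1%g] `|` \big[setU/set0]_(x <- s) \big[setU/set0]_(y <- s)
  transporter a y [set z | adj x z].
have cK : compact K.
  apply: compactU; first exact: compact_set1.
  apply: bigsetU_compact => x _; apply: bigsetU_compact => y _.
  by apply: transporter_compact => //; exact: lf.
have KP z y g : z \in s -> y \in s -> adj z (a g y) -> K g.
  move=> zs ys zy; right; rewrite -bigcup_seq; exists z => //.
  by rewrite -bigcup_seq; exists y.
apply/amenable_graphP => e e0.
(* The bounds obtained in the orbits of the elements of s are added up. *)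
pose n := (size s).+1.
have e'0 : (0 < e / n%:R)%R by rewrite divr_gt0 // ltr0n.
have [L [cL L0]] := gam K cK _ e'0.
rewrite (le_haar_ratio mu_haar) // => le.
pose A := \bigcup_(z in [set` s]) (fun g => a g z) @` L.
have fA : finite_set A.
  apply: bigcup_finite; first exact: finite_seq.
  move=> z _.
  exact: (finite_image_compact (orbit_mapP a z) (stabiliser_open a z) cL).
have fdA : finite_set (boundary A) by exact: finite_boundary.
have A0 : A !=set0.
  have [L00|/set0P[g Lg]] := eqVneq L set0.
    by move: L0; rewrite L00 measure0 ltxx.
  by exists (a g z0); exists z0 => //; exists g.
exists A; split=> //.
have bound x : x \in s ->
    ((ncard (boundary A `&` orbit_of a x))%:R <= e / n%:R * (ncard A)%:R)%R.
  move=> xs; apply: (ncard_boundary_orbit _ fA fdA cK cL _ _ _ le).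
  - exact: ltW.
  - by left.
  - by move=> g Lg; exists x => //; exists g.
  - move=> h [_ [_ [z zs [g Lg <-]] gh]]; exists g => //.
    apply: (KP z x) => //; rewrite actM; apply/(act_adj a g).
    by rewrite -actM mulgV act1.
have := @ncard_bigcup Gam _ s (fun x => orbit_of a x) _ fdA (fun x _ => sP x).
rewrite -(ler_nat R) => /le_trans; apply.
rewrite natr_sum.
apply: (@le_trans _ _ (\sum_(x <- s) (e / n%:R * (ncard A)%:R))%R).
  by rewrite !big_seq; apply: ler_sum => x xs; exact: bound.
rewrite big_const_seq count_predT iter_addr addr0 -[leLHS]mulr_natr.
have -> (N m : R) : (e / n%:R * N * m = e * N * (m / n%:R))%R.
  by rewrite -!mulrA; congr (e * _)%R; rewrite mulrC -mulrA.
rewrite ler_piMr ?mulr_ge0 ?(ltW e0) // ler_pdivrMr ?ltr0n // mul1r.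
by rewrite ler_nat /n leqnSn.
Qed.

End FolnerToGraph.

(** * From amenable graphs to Folner sets of the group *)

Section WordBalls.
Local Open Scope ring_scope.
Local Open Scope classical_set_scope.
Local Open Scope group_scope.
Variables (R : realType) (G : topologicalGroupType).
Variable mu : {measure set (borel G) -> \bar R}.
Hypothesis G_td : totally_disconnected [set: G].
Hypothesis G_lc : locally_compact [set: G].
Hypothesis mu_haar : is_left_haar mu.
Variable S : set G.
Hypotheses (cS : compact S) (symS : symmetric_set S) (genS : generates S).
Implicit Types (g h : G) (K H : set G).

(** Adding 1 to S turns words of length n into words of length at most n. *)
Fixpoint word_ball n : set G :=
  if n is m.+1 then set_mulg ([set 1] `|` S) (word_ball m) else [set 1].

Lemma word_ball_compact n : compact (word_ball n).
Proof.
elim: n => [|n IH] /=; first exact: compact_set1.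
by apply: compact_mulg => //; apply: compactU => //; exact: compact_set1.
Qed.

Lemma word_ball_mono m n : (m <= n)%N -> word_ball m `<=` word_ball n.
Proof.
move=> /subnK <-; elim: (n - m)%N => [//|k IH] g /IH gk; rewrite addSn /=.
by exists 1; [left|exists g => //; rewrite mul1g].
Qed.

Lemma word_ballM m n g h :
  word_ball m g -> word_ball n h -> word_ball (m + n) (g * h).
Proof.
elim: m g => [|m IH] g /=; first by move=> ->; rewrite mul1g.
move=> [s Ss [k wk <-]] wh; exists s => //.
by exists (k * h); [exact: IH|rewrite mulgA].
Qed.

Lemma word_ballV n g : word_ball n g -> word_ball n g^-1.
Proof.
elim: n g => [|n IH] g /=; first by move=> ->; rewrite invg1.
move=> [s Ss [k wk <-]]; rewrite invgM.
change (word_ball n.+1 (k^-1 * s^-1)); rewrite -addn1.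
apply: word_ballM; first exact: IH.
exists s^-1; last by exists 1; rewrite ?mulg1.
by case: Ss => [->|Ss]; [left; rewrite invg1|right; exact: symS].
Qed.

Lemma word_ball_is_word n g :
  word_ball n g -> exists2 m, (m <= n)%N & is_word S m g.
Proof.
elim: n g => [|n IH] g /=.
  by move=> ->; exists 0%N => //; exists [::]; rewrite big_nil.
move=> [s Ss [k /IH[m mn [t [tm tS tk]]] <-]].
case: Ss => [->|Ss]; first by exists m; [exact: leqW|exists t; rewrite mul1g].
exists m.+1 => //; exists (s :: t); split; first by rewrite /= tm.
  by move=> x; rewrite inE => /predU1P[->//|]; exact: tS.
by rewrite big_cons tk.
Qed.

Lemma bigcup_word_ball : \bigcup_n word_ball n = setT.
Proof.
apply: genS; last first.
  by move=> s Ss; exists 1%N => //; exists s; [right|exists 1; rewrite ?mulg1].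
split; first by exists 0%N.
  move=> g h [m _ wg] [n _ wh]; exists (m + n)%N => //.
  exact: word_ballM.
by move=> g [n _ wg]; exists n => //; exact: word_ballV.
Qed.

(** Some ball meets H in a set F of more than half the measure of H.  For h in H
    the sets hF and F, both contained in H, must intersect, so h lies in
    F F^-1. *)
Lemma subgroup_sub_word_ball H :
  compact_open_subgroup H -> exists n, H `<=` word_ball n.
Proof.
move=> coH; have [[H1 HM HV] cH oH] := coH.
have [q q0 qE] := haar_subgroupE G_td mu_haar coH.
pose F n := H `&` word_ball n.
have cF n : compact (F n).
  apply: compact_closedI => //; apply: td_compact_closed => //.
  exact: word_ball_compact.
have mF n := compact_measurable_borel G_td (cF n).
have FH : \bigcup_n F n = H by rewrite -setI_bigcupr bigcup_word_ball setIT.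
have mH := compact_measurable_borel G_td cH.
have [n Fn] : exists n, ((q / 2)%:E < mu (F n))%E.
  apply: contrapT => nex.
  have cvg : mu \o F @ \oo --> mu (\bigcup_n F n).
    apply: nondecreasing_cvg_mu => //; first by rewrite FH.
    move=> m n mn; apply/subsetPset => g [Hg wg]; split=> //.
    exact: word_ball_mono wg.
  have : (mu (\bigcup_n F n) <= (q / 2)%:E)%E.
    rewrite -(cvg_lim _ cvg) //; apply: lime_le.
      by apply/cvg_ex; exists (mu (\bigcup_n F n)).
    apply: nearW => n; rewrite leNgt; apply/negP => lt.
    by apply: nex; exists n.
  rewrite FH qE lee_fin ler_pdivlMr // => h.
  by move: q0; rewrite ltNge -(gerDl q) -mulr2n -mulr_natr h.
exists (n + n)%N => h Hh.
have [[_ [[_ -> [e [He we] <-]] [_ whe]]]|dis] :=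
    pselect (set_mulg [set h] (F n) `&` F n !=set0).
  by rewrite -(mulgK e h); apply: word_ballM => //; exact: word_ballV.
exfalso; have mhF : measurable (set_mulg [set h] (F n) : set (borel G)).
  apply: compact_measurable_borel => //; apply: compact_mulg => //.
  exact: compact_set1.
have : (mu (F n) + mu (F n) <= mu H)%E.
  rewrite -[X in (X + _)%E](haar_left_invariant mu_haar h (mF n)) -measureU //.
    apply: le_mu => //; first exact: measurableU.
    by move=> g [[_ -> [e [He _] <-]]|[]//]; exact: HM.
  by rewrite -subset0 => z zz; apply: dis; exists z.
rewrite qE; move: Fn; rewrite (haar_fineE mu_haar (cF n)) -EFinD.
rewrite lte_fin lee_fin ltr_pdivrMr // mulr_natr mulr2n => lt le.
by have := lt_le_trans lt le; rewrite ltxx.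
Qed.

(** K meets only finitely many cosets of a compact open subgroup, which itself
    lies in a ball. *)
Lemma compact_sub_word_ball K : compact K -> exists n, K `<=` word_ball n.
Proof.
move=> cK; have [H coH] := exists_compact_open_subgroup G_td G_lc.
have [n Hn] := subgroup_sub_word_ball coH; have [sH _ oH] := coH.
have fK := finite_image_compact (left_cosetP sH) oH cK.
have /choice [w wP] : forall C : set G,
    exists m, (left_coset H @` K) C -> C `<=` word_ball m.
  move=> C; have [[g Kg <-]|nC] := pselect ((left_coset H @` K) C); last first.
    by exists 0%N.
  have [m _ gm] : (\bigcup_n word_ball n) g by rewrite bigcup_word_ball.
  exists (m + n)%N => _ _ [_ -> [h Hh <-]].
  by apply: word_ballM => //; exact: Hn.
exists (\sum_(C <- fset_set (left_coset H @` K)) w C)%N => g Kg.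
have KC : (left_coset H @` K) (left_coset H g) by exists g.
have wg : word_ball (w (left_coset H g)) g.
  apply: (wP _ KC); exists g => //; exists 1; rewrite ?mulg1 //.
  by case: sH.
apply: word_ball_mono wg.
rewrite (big_rem (left_coset H g)) /= ?leq_addr //.
by rewrite in_fset_set // inE.
Qed.

End WordBalls.

Section GraphToFolner.
Local Open Scope ring_scope.
Local Open Scope classical_set_scope.
Local Open Scope group_scope.
Local Open Scope ereal_scope.
Variables (R : realType) (G : topologicalGroupType).
Variable mu : {measure set (borel G) -> \bar R}.
Hypothesis G_td : totally_disconnected [set: G].
Hypothesis G_lc : locally_compact [set: G].
Hypothesis mu_haar : is_left_haar mu.
Variables (Gam : graph) (a : graph_action G Gam).
Hypothesis pa : proper_action a.

(** The bound r is common to all base points, as is needed for an action with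
    infinitely many orbits. *)
Lemma lipschitz_short_walk S (C : R) n : (0 < C)%R -> exists r, forall x,
  (forall g h,
    graph_dist R (a g x) (a h x) <= C%:E * word_dist R S g h) ->
  forall g k, word_ball S n k ->
  exists2 m, (m <= r)%N & walk m (a g x) (a (g * k)%g x).
Proof.
move=> C0; exists (Num.bound (C * n%:R)%R) => x lip g k.
move=> /word_ball_is_word [m mn wk].
have Cn0 : (0 <= C * n%:R)%R by rewrite mulr_ge0 // ltW.
have : graph_dist R (a g x) (a (g * k)%g x) < (Num.bound (C * n%:R))%:R%:E.
  apply: le_lt_trans (lip _ _) _.
  apply: (@le_lt_trans _ _ (C * n%:R)%:E); last by rewrite lte_fin archi_boundP.
  rewrite EFinM lee_pmul2l // ?lte_fin //.
  apply: (@le_trans _ _ m%:R%:E); last by rewrite lee_fin ler_nat.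
  by apply: ereal_inf_lbound; exists m => //=; rewrite mulKg.
move=> /ereal_inf_lt [_ [l wl <-]]; rewrite lte_fin ltr_nat => lr.
by exists l => //; exact: ltnW.
Qed.

(** The r-neighbourhood of a finite set with small boundary adds few points to
    it in some orbit, and the orbit map of that orbit transfers this to the
    group, where right multiplication by K moves orbit points by at most r. *)
Theorem lipschitz_to_geometric : bounded_degree Gam -> amenable_graph Gam R ->
  lipschitz_action a R -> geometrically_amenable_group mu.
Proof.
move=> [D degD] /amenable_graphP am [C [C0 [S [cS symS genS lip]]]] K cK e e0.
have [n Kn] := compact_sub_word_ball G_td G_lc mu_haar cS symS genS cK.
have [r walkr] := lipschitz_short_walk S n C0.
(* M bounds the growth of finite sets under r-fold thickening. *)
pose M := (D.+1 ^ r)%N; have M0 : (0 < M)%N by rewrite expn_gt0.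
have [|A [fA A0 fdA dA]] := am (e / M%:R)%R; first by rewrite divr_gt0 // ltr0n.
pose Z := thicken r (boundary A).
have [fZ cZ] := ncard_thicken r degD fdA.
have ZA : ((ncard Z)%:R <= e * (ncard A)%:R)%R.
  apply: (@le_trans _ _ (M%:R * (ncard (boundary A))%:R)%R).
    by rewrite -natrM ler_nat.
  by rewrite -ler_pdivlMl ?ltr0n // mulrA [(M%:R^-1 * e)%R]mulrC.
have [y Ay] := pigeonhole_fibre (orbit_of a) (ltW e0) fA fZ A0 ZA.
have [|x yx lipx] := lip (orbit_of a y); first by exists y.
have xy := orbit_eq yx.
have orbE B : B `&` [set z | orbit_of a z = orbit_of a y] = B `&` orbit_of a x.
  congr (B `&` _); apply/seteqP; split=> z /=; rewrite xy.
    by move=> /esym /orbit_eqP.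
  by move=> /orbit_eqP.
rewrite !orbE => le.
have [q q0 qE] := haar_subgroupE G_td mu_haar (stabiliser_compact_open x pa).
pose U := transporter a x A; have cU : compact U by exact: transporter_compact.
have muU : mu U = ((ncard (A `&` orbit_of a x))%:R * q)%:E.
  by rewrite (haar_transporter _ _ mu_haar) // qE EFinM.
have U0 : 0 < mu U.
  rewrite muU lte_fin mulr_gt0 // ltr0n; apply: ncard_gt0.
    by apply: sub_finite_set fA => z [].
  by exists y; split=> //; rewrite -xy; exact: orbit_refl.
exists U; split=> //; rewrite (le_haar_ratio mu_haar) //.
have mT B := open_measurable_borel (transporter_open a x B).
have UK : set_mulg U K `<=` U `|` transporter a x Z.
  move=> _ [g Ug [k Kk <-]]; have [m mr w] := walkr x lipx g k (Kn _ Kk).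
  have [|tw] := walk_thicken_boundary Ug w; first by left.
  by right; apply: thicken_mono tw.
apply: (@le_trans _ _ (mu (U `|` transporter a x Z))).
  apply: le_mu => //; last by apply: measurableU; exact: mT.
  by apply: compact_measurable_borel => //; exact: compact_mulg.
have le2 : mu (U `|` transporter a x Z) <= mu U + mu (transporter a x Z).
  by apply: measureU2; exact: mT.
apply: le_trans le2 _; rewrite muU (haar_transporter _ _ mu_haar) // qE.
rewrite -!EFinM -EFinD lee_fin.
by rewrite mulrDl mul1r lerD2l mulrA ler_pM2r.
Qed.

End GraphToFolner.

(** * Quasitransitive actions are Lipschitz *)

Section QuasitransitiveToLipschitz.
Local Open Scope ring_scope.
Local Open Scope classical_set_scope.
Local Open Scope group_scope.
Variables (G : topologicalGroupType) (Gam : graph) (a : graph_action G Gam).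
Implicit Types (x y z : Gam) (g h : G) (S : set G).

Definition symmetrised S : set G := S `|` [set g | S g^-1].

Lemma act_neighbours g x :
  [set y | adj (a g x) y] = a g @` [set y | adj x y].
Proof.
apply/seteqP; split=> [y gxy|_ [y xy <-]]; last exact/act_adj.
exists (a g^-1 y); last by rewrite -actM mulgV act1.
by apply/(act_adj a g); rewrite -actM mulgV act1.
Qed.

Lemma quasitransitive_bounded_degree : locally_finite_graph Gam ->
  quasitransitive_action a -> bounded_degree Gam.
Proof.
move=> /choice [n nP] /quasitransitive_representatives [s sP].
exists (\sum_(x <- s) n x)%N => y.
have [x xs [g _ <-]] := sP y; rewrite act_neighbours.
apply: card_le_trans (card_image_le _ _) _.
have /card_eqPle [le _] := nP x; apply: card_le_trans le _.
by rewrite card_le_II (big_rem x) //= leq_addr.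
Qed.

(** The orbit map takes finitely many values on a compact set. *)
Lemma short_walks_on_compact S x : connected_graph Gam -> compact S ->
  exists N, forall t, S t -> exists2 m, (m <= N)%N & walk m x (a t x).
Proof.
move=> [_ /(_ x) /choice [w wP]] cS.
have fS := finite_image_compact (orbit_mapP a x) (stabiliser_open a x) cS.
exists (\sum_(y <- fset_set ((fun t => a t x) @` S)) w y)%N => t St.
exists (w (a t x)) => //; rewrite (big_rem (a t x)) /= ?leq_addr //.
by rewrite in_fset_set // inE; exists t.
Qed.

Lemma word_walk S x N n g :
  (forall t, S t -> exists2 m, (m <= N)%N & walk m x (a t x)) ->
  is_word S n g -> exists2 m, (m <= n * N)%N & walk m x (a g x).
Proof.
move=> SN [s [<- sS <-]]; elim: s sS => [|t s IH] sS.
  by exists 0%N => //; rewrite big_nil /= act1.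
have [m mN xt] := SN t (sS t (mem_head _ _)).
have [|k kN ts] := IH; first by move=> u us; apply: sS; rewrite inE us orbT.
exists (m + k)%N; first by rewrite /= mulSn leq_add.
rewrite big_cons actM; apply: walk_cat xt _; exact: act_walk.
Qed.

Lemma quasitransitive_lipschitz (R : realType) : compactly_generated G ->
  connected_graph Gam -> quasitransitive_action a -> lipschitz_action a R.
Proof.
move=> [S0 [cS0 gS0]] cG /quasitransitive_representatives [s sP].
pose S := symmetrised S0.
have cS : compact S by apply: compactU => //; exact: compact_preimage_invg.
have /choice [N NP] x := short_walks_on_compact x cG cS.
(* The successor makes the constant positive. *)
pose C := (\sum_(x <- s) N x).+1.
exists C%:R%R; split; first by rewrite ltr0n.
exists S; split=> //.
- by move=> g [Sg|Sg]; [right; rewrite /= invgK|left].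
- by move=> H sH SH; apply: gS0 => //; apply: subset_trans SH => g; left.
move=> O [y _ <-]; have [x xs xy] := sP y.
exists x; first by rewrite -(orbit_eq xy); exact: orbit_refl.
move=> g h; rewrite -lee_pdivrMl ?ltr0n //.
apply: le_ereal_inf_tmp => _ [n wn <-].
rewrite lee_pdivrMl ?ltr0n // -EFinM -natrM.
have [m mN xgh] := word_walk (NP x) wn.
apply: (@le_trans _ _ (m%:R%:E)%E).
  apply: ereal_inf_lbound; exists m => //=.
  by have := act_walk a g xgh; rewrite -actM mulVKg.
rewrite lee_fin ler_nat; apply: leq_trans mN _; rewrite mulnC leq_mul2r.
by apply/orP; right; rewrite /C (big_rem x) //= ltnW // ltnS leq_addr.
Qed.

End QuasitransitiveToLipschitz.

(** * The Cayley-Abels graph *)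

Section CayleyAbels.
Local Open Scope classical_set_scope.
Local Open Scope group_scope.
Variables (G : topologicalGroupType) (H S : set G).
Hypotheses (coH : compact_open_subgroup H) (cS : compact S).
Hypothesis genS : generates S.
Implicit Types (g h : G).

Let sH : is_subgroup H. Proof. by case: coH. Qed.

Definition coset_space := {C : set G | `[< exists g, C = left_coset H g >]}.

Fact coset_vertex_subproof g : `[< exists h, left_coset H g = left_coset H h >].
Proof. by apply/asboolP; exists g. Qed.

Definition coset_vertex g : coset_space :=
  exist _ (left_coset H g) (coset_vertex_subproof g).

Lemma coset_vertexP g h : coset_vertex g = coset_vertex h <-> H (g^-1 * h).
Proof.
by rewrite -left_cosetP//; split=> [/(congr1 val)//|e]; apply: val_inj.
Qed.

Lemma coset_vertex_surj (C : coset_space) : exists g, C = coset_vertex g.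
Proof.
by case: C => C /[dup] /asboolP[g e] p; exists g; apply: val_inj.
Qed.

(** Being a union of double cosets of H, this set makes the adjacency of two
    cosets independent of the chosen representatives. *)
Definition linking_set : set G := set_mulg (set_mulg H (symmetrised S)) H.

Lemma linking_setV g : linking_set g -> linking_set g^-1.
Proof.
have [H1 HM HV] := sH.
move=> [_ [h Hh [s Ss <-]] [k Hk <-]]; exists (k^-1 * s^-1).
  exists k^-1; first exact: HV.
  by exists s^-1 => //; case: Ss => Ss; [right; rewrite /= invgK|left].
by exists h^-1; [exact: HV|rewrite !invgM mulgA].
Qed.

Definition coset_adj (C D : coset_space) : Prop := C <> D /\
  exists g h,
    [/\ C = coset_vertex g, D = coset_vertex h & linking_set (g^-1 * h)].

Lemma coset_adjE g h : coset_adj (coset_vertex g) (coset_vertex h) <->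
  ~ H (g^-1 * h) /\ linking_set (g^-1 * h).
Proof.
have [H1 HM HV] := sH.
rewrite /coset_adj coset_vertexP; split=> [[nH adjgh]|[nH l]]; split=> //;
  last by exists g, h.
case: adjgh => g' [h' [/coset_vertexP gg' /coset_vertexP hh' l]].
have -> : g^-1 * h = (g^-1 * g') * (g'^-1 * h') * (h^-1 * h')^-1.
  by rewrite invgM invgK !mulgA !mulgK.
case: l => _ [k Hk [s Ss <-]] [k' Hk' <-].
exists ((g^-1 * g' * k) * s).
  by exists (g^-1 * g' * k) => //; [exact: HM|exists s].
exists (k' * (h^-1 * h')^-1); last by rewrite !mulgA.
by apply: HM => //; exact: HV.
Qed.

Lemma coset_adj_sym C D : coset_adj C D -> coset_adj D C.
Proof.
move=> [CD [g [h [eC eD l]]]]; split; first exact: nesym.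
exists h, g; split=> //; rewrite -[g in _ * g]invgK -invgM.
exact: linking_setV.
Qed.

Lemma coset_adj_irrefl C : ~ coset_adj C C.
Proof. by case. Qed.

Definition cayley_abels : graph := Graph coset_adj_sym coset_adj_irrefl.

Lemma ltranslate_left_coset g h :
  set_mulg [set g] (left_coset H h) = left_coset H (g * h).
Proof.
rewrite /left_coset !set_mulg1E.
by apply/seteqP; split=> x /=; rewrite invgM mulgA.
Qed.

Fact coset_act_subproof g (C : coset_space) :
  `[< exists h, set_mulg [set g] (val C) = left_coset H h >].
Proof.
case: C => C /= /asboolP[h ->]; apply/asboolP; exists (g * h).
exact: ltranslate_left_coset.
Qed.

Definition coset_act g (C : cayley_abels) : cayley_abels :=
  exist _ (set_mulg [set g] (val C)) (coset_act_subproof g C).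

Lemma coset_actE g h : coset_act g (coset_vertex h) = coset_vertex (g * h).
Proof. by apply: val_inj; exact: ltranslate_left_coset. Qed.

Lemma coset_act1 C : coset_act 1 C = C.
Proof. by have [g ->] := coset_vertex_surj C; rewrite coset_actE mul1g. Qed.

Lemma coset_actM g h C : coset_act (g * h) C = coset_act g (coset_act h C).
Proof. by have [k ->] := coset_vertex_surj C; rewrite !coset_actE mulgA. Qed.

Lemma coset_act_adj g C D : adj (coset_act g C) (coset_act g D) <-> adj C D.
Proof.
have [h ->] := coset_vertex_surj C; have [k ->] := coset_vertex_surj D.
by rewrite !coset_actE /adj /= !coset_adjE invgM -mulgA mulKg.
Qed.

Lemma coset_act_continuous : continuous
  (coset_act : G -> {ptws cayley_abels -> discrete_topology cayley_abels}).
Proof.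
apply/ptws_continuousP => g C; have [k ->] := coset_vertex_surj C.
have [[H1 _ HV] _ oH] := coH.
have : open [set h | H (k^-1 * (g^-1 * h) * k)].
  have -> : [set h | H (k^-1 * (g^-1 * h) * k)] =
      set_mulg (set_mulg [set g * k] H) [set k^-1].
    rewrite set_mulgE1 set_mulg1E.
    by apply/seteqP; split=> x /=; rewrite invgM invgK !mulgA.
  exact/open_rtranslate/open_ltranslate.
move=> oX; have : nbhs g [set h | H (k^-1 * (g^-1 * h) * k)].
  by apply: open_nbhs_nbhs; split=> //=; rewrite mulVg mulg1 mulVg.
apply: filterS => h /= Hh; rewrite !coset_actE; apply/esym/coset_vertexP.
by rewrite invgM -!mulgA in Hh *.
Qed.

Definition cayley_abels_action : graph_action G cayley_abels :=
  GraphAction coset_act1 coset_actM coset_act_adj coset_act_continuous.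

Lemma cayley_abels_proper : proper_action cayley_abels_action.
Proof.
move=> C; have [k ->] := coset_vertex_surj C; have [_ cH _] := coH.
have -> : stabiliser cayley_abels_action (coset_vertex k) =
    set_mulg (set_mulg [set k] H) [set k^-1].
  rewrite set_mulgE1 set_mulg1E; apply/seteqP.
  split=> x /=; rewrite /stabiliser /= coset_actE invgK.
    by move=> /esym /coset_vertexP; rewrite mulgA.
  by move=> Hx; apply/esym/coset_vertexP.
by apply: compact_mulg; [apply: compact_mulg => //|]; exact: compact_set1.
Qed.

Lemma cayley_abels_transitive : transitive_action cayley_abels_action.
Proof.
have orbitT C : orbit_of cayley_abels_action C = setT.
  apply/seteqP; split=> // D _.
  have [g ->] := coset_vertex_surj C; have [h ->] := coset_vertex_surj D.
  by exists (h * g^-1) => //=; rewrite coset_actE mulgVK.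
exists setT; apply/seteqP; split=> [_ [C _ <-]|_ ->]; first exact: orbitT.
by exists (coset_vertex 1) => //; exact: orbitT.
Qed.

(** The neighbours of the coset of g are among the cosets met by the compact set
    g linking_set. *)
Lemma cayley_abels_locally_finite : locally_finite_graph cayley_abels.
Proof.
move=> C; have [g ->] := coset_vertex_surj C; have [_ cH oH] := coH.
apply: (@sub_finite_set _ _
  (coset_vertex @` set_mulg [set g] linking_set)).
  move=> D; have [h ->] := coset_vertex_surj D => /coset_adjE[_ l].
  by exists h => //; exists g => //; exists (g^-1 * h) => //; rewrite mulVKg.
apply: (finite_image_compact coset_vertexP) => //.
apply: compact_mulg; first exact: compact_set1.
do 2 (apply: compact_mulg => //); apply: compactU => //.
by apply: compact_preimage_invg.
Qed.

(** The elements of G that carry the base coset into its connected component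
    form a subgroup containing S. *)
Lemma cayley_abels_connected : connected_graph cayley_abels.
Proof.
have [H1 HM HV] := sH.
split; first by exists (coset_vertex 1).
pose a := cayley_abels_action; pose o : cayley_abels := coset_vertex 1.
pose L := [set g | exists n, walk n o (a g o)].
have aE g : a g o = coset_vertex g by rewrite /a /= coset_actE mulg1.
have sL : is_subgroup L.
  split; first by exists 0%N; rewrite act1.
    move=> g h [n gn] [m hm]; exists (n + m)%N; rewrite actM.
    by apply: walk_cat gn _; exact: act_walk.
  move=> g [n gn]; exists n; apply: walk_sym.
  by have := act_walk a g^-1 gn; rewrite -actM mulVg act1.
have LT : L = setT.
  apply: genS => // s Ss; have [Hs|nHs] := pselect (H s).
    exists 0%N; change (o = a s o); rewrite aE.
    by apply/coset_vertexP; rewrite invg1 mul1g.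
  exists 1%N; exists (coset_vertex s); last first.
    by change (coset_vertex s = a s o); rewrite aE.
  apply/coset_adjE; rewrite invg1 mul1g; split=> //.
  exists s; last by exists 1; rewrite ?mulg1.
  by exists 1 => //; exists s; [left|rewrite mul1g].
have oall x : exists n, walk n o x.
  have [g ->] := coset_vertex_surj x; have [n] : L g by rewrite LT.
  by rewrite aE; exists n.
move=> x y; have [n ox] := oall x; have [m oy] := oall y.
by exists (n + m)%N; apply: walk_cat oy; exact: walk_sym.
Qed.

End CayleyAbels.

(** * The equivalences *)

Local Open Scope ring_scope.

Theorem theorem1p2 (R : realType) (G : topologicalGroupType)
    (mu : {measure set (borel G) -> \bar R})
    (G_lc : locally_compact [set: G]%classic)
    (G_td : totally_disconnected [set: G]%classic)
    (G_cg : compactly_generated G)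
    (mu_haar : is_left_haar mu) :
  [<-> amenable_group mu /\ unimodular mu;
       geometrically_amenable_group mu;
       exists Gam : graph,
         [/\ bounded_degree Gam, amenable_graph Gam R
           & exists a : graph_action G Gam,
               proper_action a /\ lipschitz_action a R];
       exists Gam : graph,
         [/\ connected_graph Gam, locally_finite_graph Gam,
             amenable_graph Gam R
           & exists a : graph_action G Gam,
               proper_action a /\ quasitransitive_action a];
       exists Gam : graph,
         [/\ connected_graph Gam, locally_finite_graph Gam,
             amenable_graph Gam R
           & exists a : graph_action G Gam,
               proper_action a /\ transitive_action a];
       forall Gam : graph,
         connected_graph Gam -> locally_finite_graph Gam ->
         (exists a : graph_action G Gam,
            proper_action a /\ quasitransitive_action a) ->
         amenable_graph Gam R].
Proof.
have i12 := amenable_unimodular_geometric G_td G_lc mu_haar.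
set P1 := _ /\ unimodular mu in i12 *.
set P2 := geometrically_amenable_group mu in i12 *.
set P3 := (X in [<-> _; _; X; _; _; _]).
set P4 := (X in [<-> _; _; _; X; _; _]).
set P5 := (X in [<-> _; _; _; _; X; _]).
set P6 := (X in [<-> _; _; _; _; _; X]).
have i26 : P2 -> P6.
  move=> gam Gam [ne _] lf [a [pa qa]].
  exact: (geometric_to_graph G_td mu_haar pa gam ne lf qa).
have i65 : P6 -> P5.
  move=> all_am; have [H coH] := exists_compact_open_subgroup G_td G_lc.
  have [S [cS gS]] := G_cg.
  pose Gam := cayley_abels S coH; pose a := cayley_abels_action S coH.
  have cG : connected_graph Gam by exact: cayley_abels_connected.
  have lG : locally_finite_graph Gam by exact: cayley_abels_locally_finite.
  have pa : proper_action a by exact: cayley_abels_proper.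
  have ta : transitive_action a by exact: cayley_abels_transitive.
  exists Gam; split=> //; last by exists a.
  apply: all_am => //; exists a; split=> //; rewrite /quasitransitive_action.
  by have [orb ->] := ta; exact: finite_set1.
have i54 : P5 -> P4.
  move=> [Gam [cG lG am [a [pa [B orb]]]]]; exists Gam; split=> //.
  exists a; split=> //; rewrite /quasitransitive_action orb.
  exact: finite_set1.
have i43 : P4 -> P3.
  move=> [Gam [cG lG am [a [pa qa]]]]; exists Gam; split=> //.
    exact: quasitransitive_bounded_degree qa.
  by exists a; split=> //; exact: quasitransitive_lipschitz.
have i32 : P3 -> P2.
  move=> [Gam [bd am [a [pa la]]]].
  exact: (lipschitz_to_geometric G_td G_lc mu_haar pa bd am la).
tfae.
- by move=> /i12.
- by move=> /i26/i65/i54/i43.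
- by move=> /i32/i26/i65/i54.
- by move=> /i43/i32/i26/i65.
- by move=> /i54/i43/i32/i26.
- by move=> /i65/i54/i43/i32/i12.
Qed.
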